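(* Let $m,n\ge 1$, let $\Theta\in H^\infty(\mathbb{D},\mathcal{L}(\mathbb{C}^m,\mathbb{C}^m))$ be an inner multiplier, and let $\{G_i\}_{i=1}^n$ and $\{H_i\}_{i=1}^n$ be orthonormal sets in $H^2_{\mathbb{C}^m}(\mathbb{D})$. Define $T_n:H^2_{\mathbb{C}^m}(\mathbb{D})\to H^2_{\mathbb{C}^m}(\mathbb{D})$ by $T_n(F)=T_\Theta(F)+\sum_{i=1}^n\langle F,G_i\rangle H_i$. Then the subspace $\operatorname{Ker}T_n$ is nearly $S^*$-invariant with defect at most $n$, and the defect space is $$\mathcal{F}=\bigvee_{i=1}^n\{T_{\Theta^*}(S^*H_i)\}=\bigvee_{i=1}^n\{S^*(T_{\Theta^*}H_i)\}.$$
   Context: $\mathbb{D}$ is the open unit disc and $\mathbb{T}$ the unit circle. $H^2_{\mathbb{C}^m}(\mathbb{D})$ is the $\mathbb{C}^m$-valued Hardy space, identified via radial boundary values with a closed subspace of $L^2(\mathbb{T},\mathbb{C}^m)$; $P_m$ is the orthogonal projection of $L^2(\mathbb{T},\mathbb{C}^m)$ onto $H^2_{\mathbb{C}^m}(\mathbb{D})$. For $\Phi\in L^\infty(\mathbb{T},\mathcal{L}(\mathbb{C}^m,\mathbb{C}^m))$ the Toeplitz operator is $T_\Phi F=P_m(\Phi F)$, $F\in H^2_{\mathbb{C}^m}(\mathbb{D})$; $\Phi^*$ denotes the pointwise adjoint on $\mathbb{T}$. $H^\infty(\mathbb{D},\mathcal{L}(\mathbb{C}^m,\mathbb{C}^m))$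 is the space of bounded analytic $\mathcal{L}(\mathbb{C}^m,\mathbb{C}^m)$-valued functions on $\mathbb{D}$, regarded as a subspace of $L^\infty(\mathbb{T},\mathcal{L}(\mathbb{C}^m,\mathbb{C}^m))$; an element $\Theta$ is an inner multiplier if $\Theta(e^{it})$ is an isometry for almost every $e^{it}\in\mathbb{T}$. $S$ is the forward shift $SF(z)=zF(z)$ on $H^2_{\mathbb{C}^m}(\mathbb{D})$ and $S^*$ is its adjoint, the backward shift $S^*F(z)=(F(z)-F(0))/z$. $\bigvee$ denotes the (closed) linear span. A closed subspace $\mathcal{M}\subset H^2_{\mathbb{C}^m}(\mathbb{D})$ is nearly $S^*$-invariant with defect $p$ if there is a $p$-dimensional subspace $\mathcal{F}\subset H^2_{\mathbb{C}^m}(\mathbb{D})$ (which may be taken to be orthogonal to $\mathcal{M}$) such that $F\in\mathcal{M}$ and $F(0)=0$ imply $S^*F\in\mathcal{M}+\mathcal{F}$; such an $\mathcal{F}$ is called the defect space. ''Defect at most $n$ with defect space $\mathcal{F}$'' means that $\dim\mathcal{F}\le n$ and this implication holds with $\mathcal{F}$. *)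

(* Defs.v *)
From HB Require Import structures.
From mathcomp Require Import all_boot all_order all_algebra.
From mathcomp Require Import complex.
From mathcomp Require Import all_classical all_reals all_analysis.

Set Implicit Arguments.
Unset Strict Implicit.
Unset Printing Implicit Defensive.

Import Order.TTheory GRing.Theory Num.Theory.
Import Normc.
Import numFieldNormedType.Exports.

Local Open Scope classical_set_scope.
Local Open Scope ring_scope.
Local Open Scope complex_scope.
Local Open Scope sesquilinear_scope.

Section Matrices.
Context {R : realType}.

(* Euclidean norm on columns; for general matrices the Frobenius norm, which
   is used only for convergence and boundedness. *)
Definition mxnorm p q (A : 'M[R[i]]_(p, q)) : R :=
  Num.sqrt (\sum_(i < p) \sum_(j < q) normc (A i j) ^+ 2).

Definition isometry_mx m (A : 'M[R[i]]_m) : Prop :=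
  forall v : 'cV[R[i]]_m, mxnorm (A *m v) = mxnorm v.

Definition power_series_on_disc p q (A : nat -> 'M[R[i]]_(p, q))
    (f : R[i] -> 'M[R[i]]_(p, q)) : Prop :=
  forall z : R[i], normc z < 1 ->
    (fun N : nat => mxnorm (f z - \sum_(k < N) z ^+ k *: A k)) @ \oo --> (0 : R).

End Matrices.

(* A function on the unit circle is encoded as a function of the angle t, that
   is, F t stands for F(e^{it}); only the values for t in [0, 2 pi] matter, and
   two functions are the same element of L^2 or L^oo when they agree for almost
   every such t.  Sets of L^2 functions closed in the L^2 seminorm are stable
   under almost everywhere equality. *)
Section Circle.
Context {R : realType}.

Definition angles : set R := `[0, 2 * pi].

Definition expi (t : R) : R[i] := cos t +i* sin t.

Definition ae_circle (P : R -> Prop) : Prop :=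
  {ae (@lebesgue_measure R), forall t, angles t -> P t}.

Definition measurable_circle p q (F : R -> 'M[R[i]]_(p, q)) : Prop :=
  forall i j, measurable_fun angles (fun t => complex.Re (F t i j)) /\
              measurable_fun angles (fun t => complex.Im (F t i j)).

Definition circle_mean (f : R -> R[i]) : R[i] :=
  ((2 * pi)^-1 * \int[lebesgue_measure]_(t in angles) complex.Re (f t))
  +i* ((2 * pi)^-1 * \int[lebesgue_measure]_(t in angles) complex.Im (f t)).

Definition L2sqnorm p q (F : R -> 'M[R[i]]_(p, q)) : \bar R :=
  (((2 * pi)^-1)%:E *
     \int[lebesgue_measure]_(t in angles) (mxnorm (F t) ^+ 2)%:E)%E.

Section VectorValued.
Variable m : nat.
Implicit Types (F G K : R -> 'cV[R[i]]_m) (M D : set (R -> 'cV[R[i]]_m)).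

Definition L2 F : Prop := measurable_circle F /\ (L2sqnorm F < +oo)%E.

Definition inner F G : R[i] :=
  circle_mean (fun t => \sum_(k < m) F t k 0 * (G t k 0)^*).

(* f is the analytic function on the open unit disc, with square-summable
   Taylor coefficients, whose radial boundary value is F.  As F is an element
   of L^2, the radial limit f(r e^{it}) -> F(e^{it}), r -> 1-, is that of L^2. *)
Definition hardy_extension F (f : R[i] -> 'cV[R[i]]_m) : Prop :=
  (exists2 A : nat -> 'cV[R[i]]_m,
     (\sum_(0 <= k <oo) (mxnorm (A k) ^+ 2)%:E < +oo)%E &
     power_series_on_disc A f) /\
  (fun r : R => L2sqnorm (fun t => f (r%:C * expi t) - F t)) @ 1^'- --> 0%E.

Definition H2 : set (R -> 'cV[R[i]]_m) :=
  [set F | L2 F /\ exists f, hardy_extension F f].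

(* F(0), the value at the centre of the disc. *)
Definition at0 F : 'cV[R[i]]_m := (xget 0 [set f | hardy_extension F f]) 0.

Definition backward_shift F : R -> 'cV[R[i]]_m :=
  fun t => (expi t)^-1 *: (F t - at0 F).

(* The orthogonal projection of L^2 onto H2 (determined up to almost everywhere
   equality, like every element of L^2). *)
Definition hardy_proj G : R -> 'cV[R[i]]_m :=
  xget 0 [set F | H2 F /\ forall K, H2 K -> inner (G - F) K = 0].

Definition Linfty (Phi : R -> 'M[R[i]]_m) : Prop :=
  measurable_circle Phi /\ exists B : R, ae_circle (fun t => mxnorm (Phi t) <= B).

Definition Hinfty (Phi : R -> 'M[R[i]]_m) : Prop :=
  Linfty Phi /\
  exists f : R[i] -> 'M[R[i]]_m,
    [/\ exists A, power_series_on_disc A f,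
        exists B : R, forall z, normc z < 1 -> mxnorm (f z) <= B &
        ae_circle (fun t =>
          (fun r : R => mxnorm (f (r%:C * expi t) - Phi t)) @ 1^'- --> (0 : R))].

Definition inner_multiplier (Phi : R -> 'M[R[i]]_m) : Prop :=
  Hinfty Phi /\ ae_circle (fun t => isometry_mx (Phi t)).

Definition pointwise_adjoint (Phi : R -> 'M[R[i]]_m) : R -> 'M[R[i]]_m :=
  fun t => Phi t ^t*.

Definition toeplitz (Phi : R -> 'M[R[i]]_m) F : R -> 'cV[R[i]]_m :=
  hardy_proj (fun t => Phi t *m F t).

Definition orthonormal_in_H2 n (G : 'I_n -> R -> 'cV[R[i]]_m) : Prop :=
  (forall i, H2 (G i)) /\ forall i j, inner (G i) (G j) = (i == j)%:R.

Definition L2closure M : set (R -> 'cV[R[i]]_m) :=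
  [set F | L2 F /\
     forall e : R, 0 < e -> exists2 G, M G & (L2sqnorm (F - G)%R < e%:E)%E].

Definition closed_span n (v : 'I_n -> R -> 'cV[R[i]]_m) :
    set (R -> 'cV[R[i]]_m) :=
  L2closure [set F | exists c : 'I_n -> R[i], F = \sum_(i < n) c i *: v i].

Definition subspace_of_H2 M : Prop :=
  [/\ M `<=` H2, M 0 &
      forall (a : R[i]) F G, M F -> M G -> M (a *: F + G)].

Definition closed_subspace_of_H2 M : Prop :=
  subspace_of_H2 M /\ L2closure M `<=` M.

Definition has_dim M k : Prop :=
  exists v : 'I_k -> R -> 'cV[R[i]]_m,
    [/\ forall i, M (v i),
        forall c : 'I_k -> R[i],
          ae_circle (fun t => (\sum_(i < k) c i *: v i) t = 0) ->
          forall i, c i = 0 &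
        forall F, M F -> exists c : 'I_k -> R[i],
          ae_circle (fun t => F t = (\sum_(i < k) c i *: v i) t)].

Definition sum_space M D : set (R -> 'cV[R[i]]_m) :=
  [set F | exists G K, [/\ M G, D K & ae_circle (fun t => F t = (G + K) t)]].

Definition nearly_backward_invariant_defect_le M n D : Prop :=
  [/\ closed_subspace_of_H2 M,
      subspace_of_H2 D,
      exists2 k, (k <= n)%N & has_dim D k &
      forall F, M F -> at0 F = 0 -> sum_space M D (backward_shift F)].

Definition perturbed_toeplitz n (Theta : R -> 'M[R[i]]_m)
    (G H : 'I_n -> R -> 'cV[R[i]]_m) F : R -> 'cV[R[i]]_m :=
  toeplitz Theta F + \sum_(i < n) inner F (G i) *: H i.

Definition kernel_on_H2 (T : (R -> 'cV[R[i]]_m) -> R -> 'cV[R[i]]_m) :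
    set (R -> 'cV[R[i]]_m) :=
  [set F | H2 F /\ ae_circle (fun t => T F t = 0)].

End VectorValued.
End Circle.

(* Main.v *)
Require Import Defs.
From mathcomp Require Import all_boot all_order all_algebra.
From mathcomp Require Import complex.
From mathcomp Require Import all_classical all_reals all_analysis.
From mathcomp Require Import measurable_realfun ring lra.

Set Implicit Arguments.
Unset Strict Implicit.
Unset Printing Implicit Defensive.

Import Order.TTheory GRing.Theory Num.Theory.
Import Normc.
Import numFieldNormedType.Exports.

Local Open Scope classical_set_scope.
Local Open Scope ring_scope.
Local Open Scope complex_scope.
Local Open Scope sesquilinear_scope.

(* F in Ker T_n means Theta F = - sum_i <F, G_i> H_i, and multiplication by Theta
   is an isometry of L^2.  Testing S^*F against K in H^2 therefore gives
   <S^*F, K> = <F, zK> = <Theta F, Theta zK> = - sum_i <F, G_i> <H_i, Theta zK>,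
   and <H_i, Theta zK> equals both <T_{Theta^*} S^* H_i, K> and
   <S^* T_{Theta^*} H_i, K>.  Hence S^*F itself already lies in the defect space.

   H^2 is handled through its description as the set of L^2-limits of
   polynomials in e^{it} (predicate [analytic]).  The orthogonal projection onto
   H^2 exists by the Riesz-Fischer theorem, and multiplication by Theta
   preserves H^2 because Theta is the bounded radial limit of Theta(r e^{it}),
   which for r < 1 is a uniform limit of polynomials in e^{it}. *)

(** * Means and square integrability on the circle *)

Section Scalar.
Context {R : realType}.
Local Notation mu := (@lebesgue_measure R).
Local Notation D := (@angles R).
Local Notation Re := (@complex.Re R).
Local Notation Im := (@complex.Im R).
Implicit Types (f g : R -> R) (phi psi : R -> R[i]) (z w : R[i]).

(** Elements of L^2 are bare functions here, and both [at0] and [hardy_proj] are defined by choice,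
    so most identities hold only almost everywhere. Equality in H^2 is therefore tested by inner
    products against H^2, and the value at 0 is computed as the zeroth Fourier coefficient, which
    does not depend on the choice. The two descriptions of the defect space can still be equal as
    sets, because the closure in L^2 absorbs null sets. Radial limits are awkward under sums, limits
    and products, whereas approximability by polynomials is stable under them; radial limits
    intervene only in translating between the two descriptions of H^2 and in multiplying by Theta.
    Distances are kept as squared norms, and squared moduli as polynomials in real and imaginary
    parts. This avoids most square roots; the factors 2 and 4 in the estimates come from |x + y|^2
    <= 2|x|^2 + 2|y|^2. Orthonormality of both families makes F -> sum_i <F, G_i> H_i a contraction,
    so T_n is bounded and its kernel closed. The dimension of the defect space is bounded through a
    Gram-Schmidt basis. *)

Definition sqmod z : R := Re z ^+ 2 + Im z ^+ 2.

Lemma normc_sqmod z : normc z ^+ 2 = sqmod z.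
Proof. by case: z => a b; rewrite /normc sqr_sqrtr // addr_ge0 ?sqr_ge0. Qed.

Lemma normc_ge0 z : 0 <= normc z.
Proof. by case: z => a b; exact: sqrtr_ge0. Qed.

Lemma normc_real (x : R) : normc x%:C = `|x|.
Proof. by rewrite /normc /= expr0n addr0 sqrtr_sqr. Qed.

Lemma normr_Re_le z : `|Re z| <= normc z.
Proof.
by case: z => a b /=; rewrite /normc -sqrtr_sqr ler_wsqrtr // lerDl sqr_ge0.
Qed.

Lemma normr_Im_le z : `|Im z| <= normc z.
Proof.
by case: z => a b /=; rewrite /normc -sqrtr_sqr ler_wsqrtr // lerDr sqr_ge0.
Qed.

Lemma sqmod_ge0 z : 0 <= sqmod z.
Proof. by rewrite addr_ge0 ?sqr_ge0. Qed.

Lemma mulcJE z : z * Num.conj z = (sqmod z)%:C.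
Proof. by case: z => a b; apply/eqP; rewrite eq_complex /sqmod /=; apply/andP;
  split; apply/eqP; ring. Qed.

Lemma cReJ z : Re (Num.conj z) = Re z. Proof. by case: z. Qed.
Lemma cImJ z : Im (Num.conj z) = - Im z. Proof. by case: z. Qed.
Lemma cReD z w : Re (z + w) = Re z + Re w. Proof. by case: z; case: w. Qed.
Lemma cImD z w : Im (z + w) = Im z + Im w. Proof. by case: z; case: w. Qed.
Lemma cReM z w : Re (z * w) = Re z * Re w - Im z * Im w.
Proof. by case: z; case: w. Qed.
Lemma cImM z w : Im (z * w) = Re z * Im w + Im z * Re w.
Proof. by case: z => a b; case: w => c d /=; ring. Qed.

Lemma sqmodD z w : sqmod (z + w) <= 2 * sqmod z + 2 * sqmod w.
Proof.
rewrite /sqmod cReD cImD.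
have h1 := sqr_ge0 (Re z - Re w); have h2 := sqr_ge0 (Im z - Im w).
by nra.
Qed.

Lemma sqmodM z w : sqmod (z * w) = sqmod z * sqmod w.
Proof. by rewrite /sqmod cReM cImM; ring. Qed.

Lemma complex_ext z w : Re z = Re w -> Im z = Im w -> z = w.
Proof. by case: z w => [a b] [c d] /= -> ->. Qed.

Lemma sqmod_le0 z : sqmod z <= 0 -> z = 0.
Proof.
rewrite le_eqVlt ltNge sqmod_ge0 orbF /sqmod paddr_eq0 ?sqr_ge0 // !sqrf_eq0.
by move=> /andP[/eqP h1 /eqP h2]; apply: complex_ext.
Qed.

Lemma measurable_angles : @measurable _ (measurableTypeR R) D.
Proof. exact: measurable_itv. Qed.

Lemma ae_circleS (P Q : R -> Prop) :
  (forall t, D t -> P t -> Q t) -> ae_circle P -> ae_circle Q.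
Proof. by move=> h; apply: (@filterS _ (almost_everywhere mu)) => t Pt Dt; apply:
  h => //; apply: Pt. Qed.

Lemma ae_circleI (P Q : R -> Prop) :
  ae_circle P -> ae_circle Q -> ae_circle (fun t => P t /\ Q t).
Proof. by move=> hP hQ; apply: (@filterS2 _ (almost_everywhere mu) _ _ _ _ _ hP hQ)
  => t Pt Qt Dt; split; [apply: Pt|apply: Qt]. Qed.

Lemma ae_circleT (P : R -> Prop) : (forall t, D t -> P t) -> ae_circle P.
Proof. by move=> h; apply: (@filterE _ (almost_everywhere mu)) => t; exact: h. Qed.

Definition integrable_circle f := mu.-integrable D (EFin \o f).
Definition mean f : R := (2 * pi)^-1 * \int[mu]_(t in D) f t.

Lemma meanD f g : integrable_circle f -> integrable_circle g -> mean (fun t =>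
  f t + g t) = mean f + mean g.
Proof. by move=> hf hg; rewrite /mean RintegralD ?mulrDr //; exact:
  measurable_angles. Qed.

Lemma meanZ a f : integrable_circle f -> mean (fun t => a * f t) = a * mean f.
Proof.
move=> hf; rewrite /mean (RintegralZl a measurable_angles hf).
by rewrite mulrA [_ * a]mulrC -mulrA.
Qed.

Lemma integrable_circleD f g : integrable_circle f -> integrable_circle g ->
  integrable_circle (fun t => f t + g t).
Proof. by move=> hf hg; apply: (integrableD measurable_angles hf hg). Qed.

Lemma integrable_circleZ a f : integrable_circle f -> integrable_circle (fun t =>
  a * f t).
Proof. by move=> hf; apply: (integrableZl measurable_angles a hf). Qed.

Lemma integrable_circle_measurable f : integrable_circle f -> measurable_fun D f.
Proof. by move=> /measurable_int /measurable_EFinP. Qed.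

Lemma integrable_circle_le f g : measurable_fun D f -> (forall t, D t ->
  `|f t| <= g t) ->
  integrable_circle g -> integrable_circle f.
Proof.
move=> mf fg ig; apply: (le_integrable measurable_angles _ _ ig).
  exact/measurable_EFinP.
move=> t Dt /=; rewrite lee_fin; apply: le_trans (fg t Dt) _.
exact: ler_norm.
Qed.

Lemma invpi_ge0 : 0 <= (2 * pi : R)^-1.
Proof. by rewrite invr_ge0 mulr_ge0 // pi_ge0. Qed.

Lemma mean_ge0 f : (forall t, D t -> 0 <= f t) -> 0 <= mean f.
Proof. by move=> h; rewrite mulr_ge0 ?invpi_ge0 ?Rintegral_ge0. Qed.

Lemma mean_le f g : integrable_circle f -> integrable_circle g -> (forall t, D t ->
  f t <= g t) -> mean f <= mean g.
Proof.
move=> hf hg h; rewrite ler_wpM2l ?invpi_ge0 //.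
by apply: le_Rintegral => //; exact: measurable_angles.
Qed.

Lemma mean_ae f g : measurable_fun D f -> measurable_fun D g ->
  ae_circle (fun t => f t = g t) -> mean f = mean g.
Proof.
move=> mf mg h; rewrite /mean /Rintegral; congr (_ * fine _).
apply: (@ae_eq_integral _ (measurableTypeR R)).
- exact: measurable_angles.
- exact/measurable_EFinP.
- exact/measurable_EFinP.
- by apply: ae_circleS h => t _ /= ->.
Qed.

Lemma mean_eq f g : (forall t, D t -> f t = g t) -> mean f = mean g.
Proof. by move=> h; rewrite /mean; congr (_ * _); apply: eq_Rintegral =>
  t /[!inE] /h. Qed.

Lemma mu_angles : mu D = (2 * pi)%:E.
Proof.
have pi0 : 0 < 2 * pi :> R by rewrite mulr_gt0 ?pi_gt0.
by rewrite /angles lebesgue_measure_itv lte_fin pi0 -EFinB subr0.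
Qed.

Lemma integrable_circle_cst a : integrable_circle (fun=> a).
Proof.
have muD : (mu D < +oo)%E by rewrite mu_angles ltry.
apply/integrableP; split; first exact: measurable_cst.
rewrite (eq_integral (cst `|a|%:E)) ?integral_cst //.
  by rewrite lte_mul_pinfty // lee_fin.
exact: measurable_angles.
Qed.

Lemma mean_cst a : mean (fun=> a) = a.
Proof.
rewrite /mean Rintegral_cst; last exact: measurable_angles.
have h : 2 * pi != 0 :> R by rewrite lt0r_neq0 // mulr_gt0 ?pi_gt0.
have -> : fine (mu D) = 2 * pi by rewrite mu_angles.
by rewrite mulrCA mulVf ?mulr1.
Qed.

Definition cmeasurable phi := measurable_fun D (Re \o phi) /\ measurable_fun D (Im
  \o phi).
Definition cintegrable phi := integrable_circle (Re \o phi) /\ integrable_circle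
  (Im \o phi).
Definition square_integrable phi := cmeasurable phi /\ integrable_circle (sqmod \o phi).

Lemma cintegrableD phi psi : cintegrable phi -> cintegrable psi ->
  cintegrable (fun t => phi t + psi t).
Proof.
move=> [h1 h2] [h3 h4]; split.
- by rewrite (_ : _ \o _ = fun t => Re (phi t) + Re (psi t)) ?integrable_circleD
  //; apply/funext=> t /=; rewrite cReD.
- by rewrite (_ : _ \o _ = fun t => Im (phi t) + Im (psi t)) ?integrable_circleD
  //; apply/funext=> t /=; rewrite cImD.
Qed.

Lemma circle_meanD phi psi : cintegrable phi -> cintegrable psi ->
  circle_mean (fun t => phi t + psi t) = circle_mean phi + circle_mean psi.
Proof.
move=> [h1 h2] [h3 h4]; apply: complex_ext => /=.
- by rewrite -[RHS]meanD //; apply: mean_eq => t _; rewrite cReD.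
- by rewrite -[RHS]meanD //; apply: mean_eq => t _; rewrite cImD.
Qed.

Lemma circle_meanZ a phi : cintegrable phi ->
  circle_mean (fun t => a * phi t) = a * circle_mean phi.
Proof.
move=> [h1 h2]; apply: complex_ext; rewrite ?cReM ?cImM /=.
- transitivity (mean (fun t => Re a * Re (phi t) + (- Im a) * Im (phi t))).
    by apply: mean_eq => t _; rewrite cReM mulNr.
  by rewrite meanD ?meanZ ?mulNr //; exact: integrable_circleZ.
- transitivity (mean (fun t => Re a * Im (phi t) + Im a * Re (phi t))).
    by apply: mean_eq => t _; rewrite cImM.
  by rewrite meanD ?meanZ //; exact: integrable_circleZ.
Qed.

Lemma circle_mean_conj phi : cintegrable phi ->
  circle_mean (fun t => Num.conj (phi t)) = Num.conj (circle_mean phi).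
Proof.
move=> [h1 h2]; apply: complex_ext; rewrite ?cReJ ?cImJ /=.
- by apply: mean_eq => t _; rewrite cReJ.
- rewrite -mulN1r -[RHS]meanZ //; apply: mean_eq => t _.
  by rewrite cImJ mulN1r.
Qed.

Lemma circle_mean_ae phi psi : cmeasurable phi -> cmeasurable psi ->
  ae_circle (fun t => phi t = psi t) -> circle_mean phi = circle_mean psi.
Proof.
move=> [h1 h2] [h3 h4] h; apply: complex_ext => /=.
- by apply: mean_ae => //; apply: ae_circleS h => t _ /= ->.
- by apply: mean_ae => //; apply: ae_circleS h => t _ /= ->.
Qed.

Lemma circle_mean_eq phi psi : (forall t, D t -> phi t = psi t) ->
  circle_mean phi = circle_mean psi.
Proof. by move=> h; apply: complex_ext => /=; apply: mean_eq => t /h ->. Qed.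

Lemma circle_mean_cst (a : R[i]) : circle_mean (fun _ : R => a) = a.
Proof. by apply: complex_ext => /=; exact: mean_cst. Qed.

Lemma cintegrable_cst (a : R[i]) : cintegrable (fun _ : R => a).
Proof. by split; exact: integrable_circle_cst. Qed.

Lemma cintegrable_sum (I : Type) (r : seq I) (F : I -> R -> R[i]) :
  (forall i, cintegrable (F i)) -> cintegrable (fun t => \sum_(i <- r) F i t).
Proof.
move=> h; elim: r => [|i r ih].
  by under eq_fun do rewrite big_nil; exact: cintegrable_cst.
by under eq_fun do rewrite big_cons; exact: cintegrableD.
Qed.

Lemma circle_mean_sum (I : Type) (r : seq I) (F : I -> R -> R[i]) :
  (forall i, cintegrable (F i)) ->
  circle_mean (fun t => \sum_(i <- r) F i t) = \sum_(i <- r) circle_mean (F i).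
Proof.
move=> h; elim: r => [|i r ih].
  by under eq_fun do rewrite big_nil; rewrite circle_mean_cst big_nil.
under eq_fun do rewrite big_cons.
by rewrite circle_meanD ?ih ?big_cons //; exact: cintegrable_sum.
Qed.

Lemma cmeasurableD phi psi : cmeasurable phi -> cmeasurable psi ->
  cmeasurable (fun t => phi t + psi t).
Proof.
move=> [h1 h2] [h3 h4]; split.
- rewrite (_ : _ \o _ = fun t => Re (phi t) + Re (psi t)).
    exact: measurable_funD.
  by apply/funext=> t /=; rewrite cReD.
- rewrite (_ : _ \o _ = fun t => Im (phi t) + Im (psi t)).
    exact: measurable_funD.
  by apply/funext=> t /=; rewrite cImD.
Qed.

Lemma cmeasurableM phi psi : cmeasurable phi -> cmeasurable psi ->
  cmeasurable (fun t => phi t * psi t).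
Proof.
move=> [h1 h2] [h3 h4]; split.
- rewrite (_ : _ \o _ = fun t => Re (phi t) * Re (psi t) - Im (phi t) * Im (psi t)).
    by apply: measurable_funB; apply: measurable_funM.
  by apply/funext=> t /=; rewrite cReM.
- rewrite (_ : _ \o _ = fun t => Re (phi t) * Im (psi t) + Im (phi t) * Re (psi t)).
    by apply: measurable_funD; apply: measurable_funM.
  by apply/funext=> t /=; rewrite cImM.
Qed.

Lemma cmeasurable_cst (a : R[i]) : cmeasurable (fun _ : R => a).
Proof. by split; exact: measurable_cst. Qed.

Lemma cmeasurable_conj phi : cmeasurable phi -> cmeasurable (fun t => Num.conj (phi t)).
Proof.
move=> [h1 h2]; split.
- by rewrite (_ : _ \o _ = Re \o phi) //; apply/funext=> t /=; rewrite cReJ.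
- rewrite (_ : _ \o _ = fun t => - Im (phi t)).
    exact: measurableT_comp.
  by apply/funext=> t /=; rewrite cImJ.
Qed.

Lemma cmeasurable_sum (I : Type) (r : seq I) (F : I -> R -> R[i]) :
  (forall i, cmeasurable (F i)) -> cmeasurable (fun t => \sum_(i <- r) F i t).
Proof.
move=> h; elim: r => [|i r ih].
  by under eq_fun do rewrite big_nil; exact: cmeasurable_cst.
by under eq_fun do rewrite big_cons; exact: cmeasurableD.
Qed.

Lemma measurable_sqmod phi : cmeasurable phi -> measurable_fun D (sqmod \o phi).
Proof.
by move=> [h1 h2]; apply: measurable_funD; apply: measurable_funX.
Qed.

Lemma square_integrableD phi psi : square_integrable phi ->
  square_integrable psi -> square_integrable (fun t => phi t + psi t).
Proof.
move=> [mp ip] [mq iq]; have m := cmeasurableD mp mq; split => //.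
apply: (integrable_circle_le (g := fun t => 2 * sqmod (phi t) + 2 * sqmod (psi t))).
- exact: measurable_sqmod.
- by move=> t _ /=; rewrite ger0_norm ?sqmod_ge0 ?sqmodD.
- by apply: integrable_circleD; apply: integrable_circleZ.
Qed.

(** The bound on [psi] holds only almost everywhere, so the pointwise comparison
    [integrable_circle_le] does not apply and the integrals themselves are compared. *)
Lemma square_integrable_bounded phi psi (B : R) : cmeasurable psi ->
  ae_circle (fun t => normc (psi t) <= B) ->
  square_integrable phi -> square_integrable (fun t => psi t * phi t).
Proof.
move=> mq hB [mp ip]; have m := cmeasurableM mq mp; split => //.
apply/integrableP; split; first by apply/measurable_EFinP; exact: (measurable_sqmod m).
have i2 : integrable_circle (fun t => B ^+ 2 * sqmod (phi t)) by exact: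
  integrable_circleZ.
move/integrableP: i2 => [m2]; apply: le_lt_trans.
apply: ae_ge0_le_integral => //.
- exact: measurable_angles.
- by apply: measurableT_comp => //; apply/measurable_EFinP; exact: (measurable_sqmod m).
- exact: measurableT_comp.
- apply: ae_circleS hB => t _ h.
  rewrite /= lee_fin ger0_norm ?sqmod_ge0 // ger0_norm; last first.
    by rewrite mulr_ge0 ?sqr_ge0 ?sqmod_ge0.
  have n0 : 0 <= normc (psi t) by exact: normc_ge0.
  rewrite sqmodM; apply: ler_wpM2r; first exact: sqmod_ge0.
  rewrite -normc_sqmod; apply: lerXn2r; rewrite ?nnegrE //.
  exact: le_trans h.
Qed.

Lemma square_integrable_cst (a : R[i]) : square_integrable (fun _ : R => a).
Proof. by split; [exact: cmeasurable_cst | exact: integrable_circle_cst]. Qed.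

Lemma square_integrable_sum (I : Type) (r : seq I) (F : I -> R -> R[i]) :
  (forall i, square_integrable (F i)) -> square_integrable (fun t =>
    \sum_(i <- r) F i t).
Proof.
move=> h; elim: r => [|i r ih].
  by under eq_fun do rewrite big_nil; exact: square_integrable_cst.
by under eq_fun do rewrite big_cons; exact: square_integrableD.
Qed.

Lemma square_integrableZ a phi : square_integrable phi ->
  square_integrable (fun t => a * phi t).
Proof.
apply: (@square_integrable_bounded _ _ (normc a)); first exact: cmeasurable_cst.
by apply: ae_circleT.
Qed.

Lemma square_integrable_cintegrableM phi psi : square_integrable phi ->
  square_integrable psi ->
  cintegrable (fun t => phi t * Num.conj (psi t)).
Proof.
move=> [mp ip] [mq iq].
have [m1 m2] := cmeasurableM mp (cmeasurable_conj mq).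
have i : integrable_circle (fun t => sqmod (phi t) + sqmod (psi t)) by exact:
  integrable_circleD.
(* Sum of 2|ac| <= a^2 + c^2 and 2|bd| <= b^2 + d^2. One majorant, |phi|^2 + |psi|^2, serves both
   the real and the imaginary part. *)
have key (a b c d : R) : `|a * c - b * d| <= (a ^+ 2 + b ^+ 2) + (c ^+ 2 + d ^+ 2).
  rewrite ler_norml; apply/andP; split.
    have := sqr_ge0 (a + c); have := sqr_ge0 (b - d); nra.
  have := sqr_ge0 (a - c); have := sqr_ge0 (b + d); nra.
split; apply: (integrable_circle_le _ _ i) => // t _ /=.
- by rewrite cReM cReJ cImJ; apply: le_trans (key _ _ _ _) _; rewrite sqrrN.
- rewrite cImM cReJ cImJ mulrN addrC; apply: le_trans (key _ _ _ _) _.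
  by rewrite /sqmod; lra.
Qed.

Lemma circle_mean_sqmod phi : circle_mean (fun t =>
  phi t * Num.conj (phi t)) = (mean (sqmod \o phi))%:C.
Proof.
apply: complex_ext => /=.
  by apply: mean_eq => t _; rewrite mulcJE.
rewrite -[RHS](mean_cst 0); apply: mean_eq => t _; by rewrite mulcJE.
Qed.

End Scalar.

(** * The inner product of vector-valued functions *)

Section Vectors.
Context {R : realType} {m : nat}.
Local Notation mu := (@lebesgue_measure R).
Local Notation D := (@angles R).
Local Notation Re := (@complex.Re R).
Implicit Types (F G K : R -> 'cV[R[i]]_m) (a b : R[i]).

Lemma mxnorm_sq p q (A : 'M[R[i]]_(p, q)) :
  mxnorm A ^+ 2 = \sum_i \sum_j sqmod (A i j).
Proof.
rewrite /mxnorm sqr_sqrtr; last by do 2 (apply: sumr_ge0 => ? _); exact: sqr_ge0.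
by do 2 (apply: eq_bigr => ? _); rewrite normc_sqmod.
Qed.

Lemma mxnorm_col (v : 'cV[R[i]]_m) : mxnorm v ^+ 2 = \sum_k sqmod (v k 0).
Proof. by rewrite mxnorm_sq; apply: eq_bigr => i _; rewrite big_ord1. Qed.

Lemma mxnorm_ge0 p q (A : 'M[R[i]]_(p, q)) : 0 <= mxnorm A.
Proof. exact: sqrtr_ge0. Qed.

Lemma normc_le_mxnorm p q (M : 'M[R[i]]_(p, q)) i j : normc (M i j) <= mxnorm M.
Proof.
rewrite -ler_sqr ?nnegrE ?mxnorm_ge0 ?normc_ge0 // normc_sqmod mxnorm_sq.
rewrite (bigD1 i) //= (bigD1 j) //= -addrA lerDl addr_ge0 //.
  by apply: sumr_ge0 => ? _; exact: sqmod_ge0.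
by apply: sumr_ge0 => ? _; apply: sumr_ge0 => ? _; exact: sqmod_ge0.
Qed.

(** Real-valued counterpart of [L2sqnorm], faithful on [L2] only: [fine] turns an infinite integral
    into 0. *)
Definition sqnorm F : R := mean (fun t => mxnorm (F t) ^+ 2).

Lemma colD (v w : 'cV[R[i]]_m) k : (v + w) k 0 = v k 0 + w k 0.
Proof. by rewrite mxE. Qed.
Lemma colZ a (w : 'cV[R[i]]_m) k : (a *: w) k 0 = a * w k 0.
Proof. by rewrite mxE. Qed.

Lemma integrable_circle_sum (I : Type) (r : seq I) (f : I -> R -> R) :
  (forall i, integrable_circle (f i)) -> integrable_circle (fun t =>
    \sum_(i <- r) f i t).
Proof.
move=> h; elim: r => [|i r ih].
  by under eq_fun do rewrite big_nil; exact: integrable_circle_cst.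
by under eq_fun do rewrite big_cons; exact: integrable_circleD.
Qed.

Lemma mean_sum (I : Type) (r : seq I) (f : I -> R -> R) :
  (forall i, integrable_circle (f i)) ->
  mean (fun t => \sum_(i <- r) f i t) = \sum_(i <- r) mean (f i).
Proof.
move=> h; elim: r => [|i r ih].
  by under eq_fun do rewrite big_nil; rewrite mean_cst big_nil.
under eq_fun do rewrite big_cons.
by rewrite meanD ?ih ?big_cons //; exact: integrable_circle_sum.
Qed.

Lemma measurable_mxnorm_sq F : measurable_circle F ->
  measurable_fun D (fun t => mxnorm (F t) ^+ 2).
Proof.
move=> mF; under eq_fun do rewrite mxnorm_col.
apply: measurable_sum => k; apply: (@measurable_sqmod _ (fun t => F t k 0)).
exact: mF.
Qed.

Lemma L2_integrable_circle F : L2 F -> integrable_circle (fun t => mxnorm (F t) ^+ 2).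
Proof.
move=> [mF h]; apply/integrableP; split.
  by apply/measurable_EFinP; exact: measurable_mxnorm_sq.
rewrite (eq_integral (fun t : measurableTypeR R => (mxnorm (F t) ^+ 2)%:E)); last first.
  by move=> t _; rewrite gee0_abs // lee_fin sqr_ge0.
move: h; rewrite /L2sqnorm.
have p0 : 0 < (2 * pi : R)^-1 by rewrite invr_gt0 mulr_gt0 ?pi_gt0.
set I := (\int[_]_(_ in _) _)%E.
case: I => [r||_ //]; first by move=> _; rewrite ltry.
by rewrite gt0_muley // lte_fin.
Qed.

Lemma L2P F : L2 F <-> forall k, square_integrable (fun t => F t k 0).
Proof.
split=> [hF k|h].
  split; first by case: hF => mF _; exact: mF.
  apply: integrable_circle_le (L2_integrable_circle hF).
    apply: (@measurable_sqmod _ (fun t => F t k 0)); case: hF => mF _; exact: mF.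
  move=> t _ /=; rewrite ger0_norm ?sqmod_ge0 // mxnorm_col (bigD1 k) //= lerDl.
  by apply: sumr_ge0 => i _; exact: sqmod_ge0.
split; first by move=> k j; rewrite (ord1 j); case: (h k).
have : integrable_circle (fun t => mxnorm (F t) ^+ 2).
  under eq_fun do rewrite mxnorm_col.
  by apply: integrable_circle_sum => k; case: (h k).
move=> /(integrable_lty measurable_angles) hlt; rewrite /L2sqnorm.
have p0 : (0 <= ((2 * pi : R)^-1)%:E)%E by rewrite lee_fin invpi_ge0.
exact: lte_mul_pinfty.
Qed.

Lemma L2sqnormE F : L2 F -> L2sqnorm F = (sqnorm F)%:E.
Proof.
move=> /L2_integrable_circle h; rewrite /L2sqnorm /sqnorm /mean EFinM fineK //.
exact: (integrable_fin_num measurable_angles h).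
Qed.

Lemma innerE F G : L2 F -> L2 G ->
  inner F G = \sum_k circle_mean (fun t => F t k 0 * Num.conj (G t k 0)).
Proof.
move=> /L2P hF /L2P hG; rewrite /inner circle_mean_sum // => k.
exact: (square_integrable_cintegrableM (hF k) (hG k)).
Qed.

Lemma L2D F G : L2 F -> L2 G -> L2 (F + G).
Proof.
move=> /L2P hF /L2P hG; apply/L2P => k.
rewrite (_ : (fun t => _) = fun t => F t k 0 + G t k 0); first exact:
  square_integrableD.
by apply/funext => t; rewrite fctE colD.
Qed.

Lemma L2Z a F : L2 F -> L2 (a *: F).
Proof.
move=> /L2P hF; apply/L2P => k.
rewrite (_ : (fun t => _) = fun t => a * F t k 0); first exact: square_integrableZ.
by apply/funext => t; rewrite fctE colZ.
Qed.

Lemma L2_cst (v : 'cV[R[i]]_m) : L2 (fun _ : R => v).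
Proof. by apply/L2P => k; exact: square_integrable_cst. Qed.

Lemma L2_0 : L2 (0 : R -> 'cV[R[i]]_m).
Proof. exact: L2_cst. Qed.

Lemma L2N F : L2 F -> L2 (- F).
Proof. by rewrite -scaleN1r; exact: L2Z. Qed.

Lemma L2B F G : L2 F -> L2 G -> L2 (F - G).
Proof. by move=> hF hG; exact: (L2D hF (L2N hG)). Qed.

Lemma L2_sum (I : Type) (r : seq I) (F : I -> R -> 'cV[R[i]]_m) :
  (forall i, L2 (F i)) -> L2 (\sum_(i <- r) F i).
Proof.
by move=> h; elim/big_ind: _ => [|? ?|? _]; [exact: L2_0 | exact: L2D | exact: h].
Qed.

Lemma innerDl F G K : L2 F -> L2 G -> L2 K ->
  inner (F + G) K = inner F K + inner G K.
Proof.
move=> hF hG hK; rewrite (innerE (L2D hF hG) hK) (innerE hF hK) (innerE hG hK).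
rewrite -big_split /=; apply: eq_bigr => k _.
move/L2P: hF => /(_ k) hF; move/L2P: hG => /(_ k) hG; move/L2P: hK => /(_ k) hK.
rewrite -circle_meanD; try exact: square_integrable_cintegrableM.
by apply: circle_mean_eq => t _; rewrite -mulrDl fctE colD.
Qed.

Lemma innerZl a F K : L2 F -> L2 K -> inner (a *: F) K = a * inner F K.
Proof.
move=> hF hK; rewrite (innerE (L2Z a hF) hK) (innerE hF hK).
rewrite big_distrr /=; apply: eq_bigr => k _.
move/L2P: hF => /(_ k) hF; move/L2P: hK => /(_ k) hK.
rewrite -circle_meanZ; last exact: square_integrable_cintegrableM.
by apply: circle_mean_eq => t _; rewrite mulrA fctE colZ.
Qed.

Lemma innerC F G : L2 F -> L2 G -> inner G F = Num.conj (inner F G).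
Proof.
move=> hF hG; rewrite (innerE hG hF) (innerE hF hG) rmorph_sum /=.
apply: eq_bigr => k _.
move/L2P: hF => /(_ k) hF; move/L2P: hG => /(_ k) hG.
rewrite -circle_mean_conj; last exact: square_integrable_cintegrableM.
by apply: circle_mean_eq => t _; rewrite rmorphM /= conjCK mulrC.
Qed.

Lemma innerDr F G K : L2 F -> L2 G -> L2 K ->
  inner F (G + K) = inner F G + inner F K.
Proof.
move=> hF hG hK; rewrite (innerC (L2D hG hK) hF) (innerDl hG hK hF).
by rewrite rmorphD /= -(innerC hG hF) -(innerC hK hF).
Qed.

Lemma innerZr a F K : L2 F -> L2 K -> inner F (a *: K) = Num.conj a * inner F K.
Proof.
move=> hF hK; rewrite (innerC (L2Z a hK) hF) (innerZl a hK hF).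
by rewrite rmorphM /= -(innerC hK hF).
Qed.

Lemma inner0l K : L2 K -> inner 0 K = 0.
Proof.
by move=> hK; rewrite -(scale0r (0 : R -> 'cV[R[i]]_m)) (innerZl _ L2_0 hK) mul0r.
Qed.

Lemma innerNl F K : L2 F -> L2 K -> inner (- F) K = - inner F K.
Proof. by move=> hF hK; rewrite -scaleN1r (innerZl _ hF hK) mulN1r. Qed.

Lemma innerBl F G K : L2 F -> L2 G -> L2 K ->
  inner (F - G) K = inner F K - inner G K.
Proof. by move=> hF hG hK; rewrite (innerDl hF (L2N hG) hK) (innerNl hG hK). Qed.

Lemma innerNr F K : L2 F -> L2 K -> inner F (- K) = - inner F K.
Proof. by move=> hF hK; rewrite -scaleN1r (innerZr _ hF hK) rmorphN1 mulN1r. Qed.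

Lemma innerBr F G K : L2 F -> L2 G -> L2 K ->
  inner F (G - K) = inner F G - inner F K.
Proof. by move=> hF hG hK; rewrite (innerDr hF hG (L2N hK)) (innerNr hF hK). Qed.

Lemma inner_suml (I : Type) (r : seq I) (F : I -> R -> 'cV[R[i]]_m) K :
  (forall i, L2 (F i)) -> L2 K ->
  inner (\sum_(i <- r) F i) K = \sum_(i <- r) inner (F i) K.
Proof.
move=> h hK; elim: r => [|i r ih]; first by rewrite !big_nil inner0l.
by rewrite !big_cons (innerDl (h i) (L2_sum r h) hK) ih.
Qed.

Lemma L2_cmeasurable F k : L2 F -> cmeasurable (fun t => F t k 0).
Proof. by move=> /L2P /(_ k) []. Qed.

Lemma inner_ae F G K : L2 F -> L2 G -> L2 K ->
  ae_circle (fun t => F t = G t) -> inner F K = inner G K.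
Proof.
move=> hF hG hK h; rewrite (innerE hF hK) (innerE hG hK); apply: eq_bigr => k _.
apply: circle_mean_ae.
- by apply: cmeasurableM; [|apply: cmeasurable_conj]; exact: L2_cmeasurable.
- by apply: cmeasurableM; [|apply: cmeasurable_conj]; exact: L2_cmeasurable.
- by apply: ae_circleS h => t _ ->.
Qed.

Lemma sqnorm_ge0 F : 0 <= sqnorm F.
Proof. by apply: mean_ge0 => t _; exact: sqr_ge0. Qed.

Lemma inner_sqnorm F : L2 F -> inner F F = (sqnorm F)%:C.
Proof.
move=> hF; rewrite (innerE hF hF) /sqnorm.
transitivity ((\sum_k mean (fun t => sqmod (F t k 0)))%:C).
  by rewrite rmorph_sum; apply: eq_bigr => k _; exact: circle_mean_sqmod.
congr (_%:C); rewrite -mean_sum; last by move=> k; move/L2P: hF => /(_ k) [].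
by apply: mean_eq => t _; rewrite mxnorm_col.
Qed.

Lemma sqnormE F : L2 F -> sqnorm F = Re (inner F F).
Proof. by move=> /inner_sqnorm ->. Qed.

Lemma Re_innerC F G : L2 F -> L2 G -> Re (inner G F) = Re (inner F G).
Proof. by move=> hF hG; rewrite (innerC hF hG) cReJ. Qed.

Lemma sqnormD F G : L2 F -> L2 G ->
  sqnorm (F + G) = sqnorm F + sqnorm G + 2 * Re (inner F G).
Proof.
move=> hF hG; have hFG := L2D hF hG.
rewrite (sqnormE hFG) (sqnormE hF) (sqnormE hG) (innerDl hF hG hFG).
rewrite (innerDr hF hF hG) (innerDr hG hF hG) !cReD (Re_innerC hF hG); ring.
Qed.

Lemma sqnormZ a F : L2 F -> sqnorm (a *: F) = sqmod a * sqnorm F.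
Proof.
move=> hF; have haF := L2Z a hF; rewrite (sqnormE haF) (sqnormE hF) (innerZl a hF
  haF) (innerZr a hF hF).
by rewrite mulrA mulcJE cReM mul0r subr0.
Qed.

Lemma sqnormN F : L2 F -> sqnorm (- F) = sqnorm F.
Proof. by move=> hF; rewrite -scaleN1r (sqnormZ _ hF) /sqmod /= oppr0 expr0n addr0
  sqrrN expr1n mul1r. Qed.

Lemma sqnormB F G : L2 F -> L2 G ->
  sqnorm (F - G) = sqnorm F + sqnorm G - 2 * Re (inner F G).
Proof.
move=> hF hG; rewrite (sqnormD hF (L2N hG)) (sqnormN hG) (innerNr hF hG).
by case: (inner F G) => x y /=; rewrite mulrN.
Qed.

Lemma sqnormBC F G : L2 F -> L2 G -> sqnorm (F - G) = sqnorm (G - F).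
Proof. by move=> hF hG; rewrite -(sqnormN (L2B hF hG)) opprB. Qed.

(** Parallelogram law with |F - G|^2 dropped; it replaces the triangle inequality without leaving
    squared norms. *)
Lemma sqnormD_le F G : L2 F -> L2 G -> sqnorm (F + G) <= 2 * sqnorm F + 2 * sqnorm G.
Proof.
move=> hF hG; have := sqnorm_ge0 (F - G).
by rewrite (sqnormB hF hG) (sqnormD hF hG); lra.
Qed.

Lemma sqnorm_tri F G K : L2 F -> L2 G -> L2 K ->
  sqnorm (F - K) <= 2 * sqnorm (F - G) + 2 * sqnorm (G - K).
Proof.
move=> hF hG hK; apply: le_trans (sqnormD_le (L2B hF hG) (L2B hG hK)).
by rewrite addrA subrK.
Qed.

Lemma sqnorm_ae F G : L2 F -> L2 G -> ae_circle (fun t => F t = G t) ->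
  sqnorm F = sqnorm G.
Proof.
move=> hF hG h; apply: mean_ae.
- by apply: measurable_mxnorm_sq; case: hF.
- by apply: measurable_mxnorm_sq; case: hG.
- by apply: ae_circleS h => t _ ->.
Qed.

Lemma mxnorm_eq0 p q (A : 'M[R[i]]_(p, q)) : mxnorm A = 0 -> A = 0.
Proof.
move=> h; have : mxnorm A ^+ 2 = 0 by rewrite h expr0n.
rewrite mxnorm_sq => /eqP.
rewrite psumr_eq0; last by move=> i _; apply: sumr_ge0 => j _; exact: sqmod_ge0.
move=> /allP h1; apply/matrixP => i j; rewrite mxE.
have := h1 i (mem_index_enum _); rewrite psumr_eq0; last by move=> k _; exact:
  sqmod_ge0.
move=> /allP /(_ j (mem_index_enum _)) /eqP.
move=> /eqP; rewrite paddr_eq0 ?sqr_ge0 // !sqrf_eq0 => /andP[/eqP h2 /eqP h3].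
exact: complex_ext.
Qed.

Lemma sqnorm0_ae F : L2 F -> sqnorm F = 0 -> ae_circle (fun t => F t = 0).
Proof.
move=> hF h; have : L2sqnorm F = 0%E by rewrite (L2sqnormE hF) h.
rewrite /L2sqnorm => /eqP; rewrite mule_eq0 => /orP[].
  by rewrite eqe invr_eq0 gt_eqF // mulr_gt0 ?pi_gt0.
move=> /eqP hI.
have := @ae_eq_integral_abs _ (measurableTypeR R) R mu _ measurable_angles
  (fun t => (mxnorm (F t) ^+ 2)%:E).
case.
  by apply/measurable_EFinP; apply: measurable_mxnorm_sq; case: hF.
move=> h1 _; have /h1 : (\int[mu]_(x in D) `|(mxnorm (F x) ^+ 2)%:E| = 0)%E.
  by rewrite -[RHS]hI; apply: eq_integral => t _; rewrite gee0_abs // lee_fin sqr_ge0.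
move=> h2; have {h2}h2 : ae_circle (fun t => (mxnorm (F t) ^+ 2)%:E = 0%E) by [].
apply: ae_circleS h2 => t _ [] /eqP; rewrite sqrf_eq0 => /eqP; exact: mxnorm_eq0.
Qed.

Lemma sqnorm_ae0 F : L2 F -> ae_circle (fun t => F t = 0) -> sqnorm F = 0.
Proof.
move=> hF h; rewrite (sqnorm_ae hF L2_0 h).
by rewrite (sqnormE L2_0) (inner0l L2_0).
Qed.

(* Nonnegativity of |G|^2 F - <F,G> G. *)
Lemma cauchy_schwarz F G : L2 F -> L2 G -> sqmod (inner F G) <= sqnorm F * sqnorm G.
Proof.
move=> hF hG; set c := inner F G.
have key (x : R) : 0 <= x ^+ 2 * sqnorm F - 2 * x * sqmod c + sqmod c * sqnorm G.
  have := sqnorm_ge0 (x%:C *: F - c *: G).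
  rewrite (sqnormB (L2Z _ hF) (L2Z _ hG)) (sqnormZ _ hF) (sqnormZ _ hG).
  rewrite (innerZl _ hF (L2Z _ hG)) (innerZr _ hF hG) -/c.
  have -> : x%:C * (Num.conj c * c) = (x * sqmod c)%:C.
    by rewrite [_ * c]mulrC mulcJE -rmorphM.
  by rewrite {1}/sqmod /= expr0n addr0; lra.
have h0 := sqnorm_ge0 G; have h1 := sqnorm_ge0 F; have h2 := sqmod_ge0 c.
have [g0|g0] := eqVneq (sqnorm G) 0; last first.
  have gp : 0 < sqnorm G by rewrite lt_neqAle eq_sym g0.
  have := key (sqnorm G); nra.
rewrite g0 mulr0; rewrite leNgt; apply/negP => cp.
have [f0|f0] := eqVneq (sqnorm F) 0.
  by have := key 1; rewrite g0 f0; lra.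
have fp : 0 < sqnorm F by rewrite lt_neqAle eq_sym f0.
(* When |G| = 0 the choice x = |G|^2 gives nothing. The quadratic is then x^2 |F|^2 - 2 x |c|^2, and
   this x is its minimum point, where the value -|c|^4 / |F|^2 is negative. *)
have := key (sqmod c / sqnorm F); rewrite g0 mulr0 addr0.
have -> : (sqmod c / sqnorm F) ^+ 2 * sqnorm F - 2 * (sqmod c / sqnorm F) * sqmod c =
  - (sqmod c ^+ 2 / sqnorm F) by field.
rewrite oppr_ge0 leNgt => /negP; apply.
by rewrite divr_gt0 // exprn_gt0.
Qed.

Lemma Linfty_L2 (Phi : R -> 'M[R[i]]_m) F : Linfty Phi -> L2 F ->
  L2 (fun t => Phi t *m F t).
Proof.
move=> [mP [B hB]] /L2P hF; apply/L2P => k.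
rewrite (_ : (fun t => _) = fun t => \sum_j Phi t k j * F t j 0); last first.
  by apply/funext => t; rewrite mxE.
apply: square_integrable_sum => j; apply: (@square_integrable_bounded _ _ _ B) =>
  //; first exact: mP.
by apply: ae_circleS hB => t _; apply: le_trans; exact: normc_le_mxnorm.
Qed.

End Vectors.

(** * Fourier coefficients *)

Section Fourier.
Context {R : realType}.

(** Fundamental theorem of calculus over one period; the means of the nonconstant powers of e^{it}
    vanish by it. *)
Lemma mean_derive (f F : R -> R) : continuous f ->
  (forall x, is_derive x (1 : R) F (f x)) -> F (2 * pi) = F 0 -> mean f = 0.
Proof.
move=> cf dF F2; rewrite /mean /Rintegral /angles.
have pi2 : 0 < 2 * pi :> R by rewrite mulr_gt0 ?pi_gt0.
have cF : continuous F.
  move=> x; apply: differentiable_continuous; apply/derivable1_diffP.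
  by have [] := dF x.
rewrite (@continuous_FTC2 _ f F) //.
- by rewrite F2 -EFinB subrr mulr0.
- exact: continuous_subspaceT.
- split.
  + by move=> x _; have [] := dF x.
  + by apply: cvg_at_right_filter; exact: cF.
  + by apply: cvg_at_left_filter; exact: cF.
- by move=> x _; rewrite derive1E; have [_ ->] := dF x.
Qed.

Lemma expiX (t : R) n : expi t ^+ n = expi (n%:R * t).
Proof.
elim: n => [|n ih]; first by rewrite expr0 mul0r /expi cos0 sin0.
rewrite exprS ih /expi -natr1 mulrDl mul1r cosD sinD.
by apply: complex_ext; rewrite ?cReM ?cImM /=; ring.
Qed.

Lemma sqmod_expi (t : R) : sqmod (expi t) = 1.
Proof. by rewrite /sqmod /= cos2Dsin2. Qed.

Lemma expi_neq0 (t : R) : expi t != 0.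
Proof.
apply/eqP => h; have := sqmod_expi t; rewrite h /sqmod /= expr0n addr0 => /esym/eqP.
by rewrite oner_eq0.
Qed.

Lemma conj_expi (t : R) : Num.conj (expi t) = (expi t)^-1.
Proof.
apply: (mulfI (expi_neq0 t)); rewrite mulcJE sqmod_expi mulfV //; exact: expi_neq0.
Qed.

Lemma cos2pin n : cos (n%:R * (2 * pi)) = 1 :> R.
Proof.
elim: n => [|n ih]; first by rewrite mul0r cos0.
rewrite -natr1 mulrDl mul1r cosD ih.
by rewrite [2 * pi]mulrC mulr_natr cos2pi sin2pi mulr0 subr0 mulr1.
Qed.

Lemma sin2pin n : sin (n%:R * (2 * pi)) = 0 :> R.
Proof.
elim: n => [|n ih]; first by rewrite mul0r sin0.
rewrite -natr1 mulrDl mul1r sinD ih.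
by rewrite [2 * pi]mulrC mulr_natr cos2pi sin2pi mulr0 mul0r addr0.
Qed.

Lemma circle_mean_expi n : circle_mean (fun t : R => expi t ^+ n.+1) = 0.
Proof.
have n0 : (n.+1%:R : R) != 0 by rewrite pnatr_eq0.
have cc : continuous (fun t : R => cos (n.+1%:R * t)).
  move=> t; apply: (continuous_comp (g := cos)); last exact: continuous_cos.
  exact: mulrl_continuous.
have cs : continuous (fun t : R => sin (n.+1%:R * t)).
  move=> t; apply: (continuous_comp (g := sin)); last exact: continuous_sin.
  exact: mulrl_continuous.
apply: complex_ext.
- transitivity (mean (fun t : R => cos (n.+1%:R * t))).
    by apply: mean_eq => t _; rewrite expiX.
  apply: (mean_derive (F := fun t => n.+1%:R^-1 * sin (n.+1%:R * t))) => //.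
    move=> x; apply: is_derive_eq; rewrite !scaler1 /GRing.scale /=.
    by field; rewrite ?natr1 ?nat1r n0.
  by rewrite sin2pin !mulr0 sin0 mulr0.
- transitivity (mean (fun t : R => sin (n.+1%:R * t))).
    by apply: mean_eq => t _; rewrite expiX.
  apply: (mean_derive (F := fun t => - n.+1%:R^-1 * cos (n.+1%:R * t))) => //.
    move=> x; apply: is_derive_eq; rewrite !scaler1 /GRing.scale /=.
    by field; rewrite ?natr1 ?nat1r n0.
  by rewrite cos2pin !mulr0 cos0.
Qed.

End Fourier.

(** * Vector-valued Fourier coefficients and Bessel's inequality *)

Section FourierVec.
Context {R : realType} {m : nat}.
Implicit Types (F G K : R -> 'cV[R[i]]_m) (a b : R[i]) (v w : 'cV[R[i]]_m)
  (A B : nat -> 'cV[R[i]]_m).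

Lemma cmeasurable_expi : cmeasurable (@expi R).
Proof.
by split; apply: measurable_funTS; apply: continuous_measurable_fun;
  [exact: continuous_cos | exact: continuous_sin].
Qed.

Lemma cmeasurable_expiX n : cmeasurable (fun t : R => expi t ^+ n).
Proof.
elim: n => [|n ih]; first exact: (cmeasurable_cst 1).
by under eq_fun do rewrite exprS; apply: cmeasurableM => //; exact: cmeasurable_expi.
Qed.

Lemma normc_expi (t : R) : normc (expi t) = 1.
Proof. by rewrite /normc /expi cos2Dsin2 sqrtr1. Qed.

Lemma normcX (z : R[i]) n : normc (z ^+ n) = normc z ^+ n.
Proof. by elim: n => [|n ih]; rewrite ?normc1 // !exprS normcM ih. Qed.

Lemma normc_expiX (t : R) n : normc (expi t ^+ n) = 1.
Proof. by rewrite normcX normc_expi expr1n. Qed.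

Lemma square_integrable_expiX n : square_integrable (fun t : R => expi t ^+ n).
Proof.
have -> : (fun t : R => expi t ^+ n) = fun t => expi t ^+ n * 1.
  by apply/funext => t; rewrite mulr1.
apply: (@square_integrable_bounded _ (fun=> 1) _ 1); last exact: square_integrable_cst.
  exact: cmeasurable_expiX.
by apply: ae_circleT => t _; rewrite normc_expiX.
Qed.

Lemma cintegrable_expiX n : cintegrable (fun t : R => expi t ^+ n).
Proof.
have := square_integrable_cintegrableM (square_integrable_expiX n)
  (@square_integrable_cst R 1).
by under eq_fun do rewrite rmorph1 mulr1.
Qed.

Lemma circle_mean_expiX n : circle_mean (fun t : R => expi t ^+ n) = (n == 0)%:R.
Proof.
case: n => [|n]; last exact: circle_mean_expi.
exact: circle_mean_cst.
Qed.

(** Exponents are natural numbers, so the frequency k - l is written as a power when l <= k and as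
    the conjugate of the power l - k otherwise. *)
Lemma circle_mean_expi2 k l :
  circle_mean (fun t : R => expi t ^+ k * Num.conj (expi t ^+ l)) = (k == l)%:R.
Proof.
have E (t : R) i j : expi t ^+ (i + j) * Num.conj (expi t ^+ i) = expi t ^+ j.
  rewrite rmorphXn /= conj_expi exprD mulrAC exprVn mulfV ?mul1r //.
  by rewrite expf_neq0 // expi_neq0.
case: (leqP l k) => [lk|kl].
  transitivity (circle_mean (fun t : R => expi t ^+ (k - l))).
    by apply: circle_mean_eq => t _; rewrite -{1}(subnKC lk) E.
  by rewrite circle_mean_expiX subn_eq0 eqn_leq lk andbT.
transitivity (circle_mean (fun t : R => Num.conj (expi t ^+ (l - k)))).
  apply: circle_mean_eq => t _; rewrite -[LHS]conjCK rmorphM /= conjCK mulrC.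
  by rewrite -{1}(subnKC (ltnW kl)) E.
rewrite circle_mean_conj ?circle_mean_expiX; last exact: cintegrable_expiX.
by rewrite subn_eq0 leqNgt kl ltn_eqF // rmorph0.
Qed.

Definition dotc v w : R[i] := \sum_j v j 0 * Num.conj (w j 0).

Lemma dotcc v : dotc v v = (mxnorm v ^+ 2)%:C.
Proof.
by rewrite mxnorm_col rmorph_sum; apply: eq_bigr => k _; rewrite mulcJE.
Qed.

Lemma inner_cst v w : inner (fun _ : R => v) (fun=> w) = dotc v w.
Proof. exact: circle_mean_cst. Qed.

Lemma sqnorm_cst v : sqnorm (fun _ : R => v) = mxnorm v ^+ 2.
Proof. exact: mean_cst. Qed.

(** Constant functions embed C^m isometrically into L^2, the mean of a constant being that constant,
    so the inequality is the one in L^2. *)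
Lemma dotc_cauchy_schwarz v w : sqmod (dotc v w) <= mxnorm v ^+ 2 * mxnorm w ^+ 2.
Proof.
by rewrite -inner_cst -!sqnorm_cst; apply: cauchy_schwarz; exact: L2_cst.
Qed.

Lemma mxnorm_mulmx (B : 'M[R[i]]_m) v : mxnorm (B *m v) ^+ 2 <= mxnorm B ^+ 2 *
  mxnorm v ^+ 2.
Proof.
rewrite mxnorm_col [mxnorm B ^+ 2]mxnorm_sq mulr_suml; apply: ler_sum => k _.
(* [dotc] conjugates its second argument, hence the conjugated copy of [v]; the rest is
   Cauchy-Schwarz row by row. *)
have -> : (B *m v) k 0 = dotc (\col_j B k j) (\col_j Num.conj (v j 0)).
  by rewrite mxE; apply: eq_bigr => j _; rewrite !mxE conjCK.
apply: le_trans (dotc_cauchy_schwarz _ _) _; rewrite !mxnorm_col ler_pM //.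
- by apply: sumr_ge0 => ? _; exact: sqmod_ge0.
- by apply: sumr_ge0 => ? _; exact: sqmod_ge0.
- by apply: ler_sum => j _; rewrite mxE.
- by apply: ler_sum => j _; rewrite mxE /sqmod cReJ cImJ sqrrN.
Qed.

Definition monomial k v : R -> 'cV[R[i]]_m := fun t => expi t ^+ k *: v.

(** Only the frequencies 0 <= k < n occur: these are the boundary values of polynomials in z with
    vector coefficients. *)
Definition trigpoly A n : R -> 'cV[R[i]]_m := fun t => \sum_(k < n) expi t ^+ k *: A k.

Lemma trigpolyE A n : trigpoly A n = \sum_(k < n) monomial k (A k).
Proof. by apply/funext => t; rewrite fct_sumE. Qed.

Lemma L2_monomial k v : L2 (monomial k v).
Proof.
apply/L2P => j; rewrite (_ : (fun t => _) = fun t => v j 0 * expi t ^+ k).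
  exact: (square_integrableZ _ (square_integrable_expiX k)).
by apply/funext => t; rewrite /monomial mxE mulrC.
Qed.

Lemma L2_trigpoly A n : L2 (trigpoly A n).
Proof. by rewrite trigpolyE; apply: L2_sum => k; exact: L2_monomial. Qed.

Lemma inner_monomial k l v w :
  inner (monomial k v) (monomial l w) = (k == l)%:R * dotc v w.
Proof.
rewrite (innerE (L2_monomial k v) (L2_monomial l w)) /dotc mulr_sumr; apply:
  eq_bigr => j _.
transitivity (circle_mean (fun t : R => (v j 0 * Num.conj (w j 0)) *
    (expi t ^+ k * Num.conj (expi t ^+ l)))).
  by apply: circle_mean_eq => t _; rewrite /monomial !mxE rmorphM /=; ring.
rewrite circle_meanZ; last exact: (square_integrable_cintegrableM
  (square_integrable_expiX k) (square_integrable_expiX l)).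
by rewrite circle_mean_expi2 mulrC.
Qed.

Definition fourier F k : 'cV[R[i]]_m := \col_j inner F (monomial k (delta_mx j 0)).

Lemma inner_fourier F k v : L2 F -> inner F (monomial k v) = dotc (fourier F k) v.
Proof.
move=> hF; have E : monomial k v = \sum_j v j 0 *: monomial k (delta_mx j 0).
  apply/funext => t; rewrite fct_sumE /monomial.
  rewrite {1}(matrix_sum_delta v) scaler_sumr; apply: eq_bigr => j _.
  by rewrite big_ord1 fctE !scalerA mulrC.
rewrite E (innerC (F := \sum_j _) _ hF); last first.
  by apply: L2_sum => j; apply: L2Z; exact: L2_monomial.
rewrite (inner_suml _ (fun j => L2Z _ (L2_monomial _ _)) hF).
rewrite rmorph_sum; apply: eq_bigr => j _ /=.
by rewrite (innerZl _ (L2_monomial _ _) hF) rmorphM /= -(innerC (L2_monomial _ _)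
  hF) mxE mulrC.
Qed.

Lemma fourierB F G k : L2 F -> L2 G -> fourier (F - G) k = fourier F k - fourier G k.
Proof.
by move=> hF hG; apply/colP => j; rewrite !mxE (innerBl hF hG (L2_monomial _ _)).
Qed.

Lemma dotc_delta v j : dotc v (delta_mx j 0) = v j 0.
Proof.
rewrite /dotc (bigD1 j) //= mxE !eqxx rmorph1 mulr1 big1 ?addr0 // => i ij.
by rewrite mxE (negbTE ij) rmorph0 mulr0.
Qed.

Lemma fourier_monomial k l v : fourier (monomial k v) l = (k == l)%:R *: v.
Proof. by apply/colP => j; rewrite !mxE inner_monomial dotc_delta. Qed.

Lemma fourier_trigpoly A n k : fourier (trigpoly A n) k = if (k < n)%N then A k else 0.
Proof.
have -> : fourier (trigpoly A n) k = \sum_(i < n) fourier (monomial i (A i)) k.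
  apply/colP => j; rewrite !mxE trigpolyE inner_suml; last exact: L2_monomial.
    by rewrite summxE; apply: eq_bigr => i _; rewrite mxE.
  by move=> i; exact: L2_monomial.
case: ifP => kn.
  rewrite (bigD1 (Ordinal kn)) //= fourier_monomial eqxx scale1r big1 ?addr0 // => i.
  by rewrite -val_eqE /= => ik; rewrite fourier_monomial (negbTE ik) scale0r.
rewrite big1 // => i _; rewrite fourier_monomial ltn_eqF ?scale0r //.
by apply: leq_trans (ltn_ord i) _; rewrite leqNgt kn.
Qed.

Lemma inner_trigpoly F A n : L2 F -> inner F (trigpoly A n) = \sum_(k < n) dotc
  (fourier F k) (A k).
Proof.
move=> hF; rewrite trigpolyE (innerC (F := \sum_(k < n) _) _ hF); last first.
  by apply: L2_sum => k; exact: L2_monomial.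
rewrite (inner_suml _ (fun k => L2_monomial _ _) hF).
rewrite rmorph_sum; apply: eq_bigr => k _ /=.
by rewrite -(innerC (L2_monomial _ _) hF) inner_fourier.
Qed.

Lemma sqnorm_trigpoly A n : sqnorm (trigpoly A n) = \sum_(k < n) mxnorm (A k) ^+ 2.
Proof.
apply: complexI; rewrite -(inner_sqnorm (L2_trigpoly A n)) (inner_trigpoly _ _
  (L2_trigpoly A n)) rmorph_sum.
by apply: eq_bigr => k _; rewrite fourier_trigpoly ltn_ord dotcc.
Qed.

Lemma sqnormB_fourier F n : L2 F ->
  sqnorm (F - trigpoly (fourier F) n) = sqnorm F - \sum_(k < n) mxnorm (fourier F
    k) ^+ 2.
Proof.
move=> hF; rewrite (sqnormB hF (L2_trigpoly _ _)) sqnorm_trigpoly (inner_trigpoly _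
  _ hF).
have -> : \sum_(k < n) dotc (fourier F k) (fourier F k) =
   (\sum_(k < n) mxnorm (fourier F k) ^+ 2)%:C.
  by rewrite rmorph_sum; apply: eq_bigr => k _; rewrite dotcc.
by rewrite /=; ring.
Qed.

Lemma bessel F n : L2 F -> \sum_(k < n) mxnorm (fourier F k) ^+ 2 <= sqnorm F.
Proof. by move=> hF; rewrite -subr_ge0 -sqnormB_fourier // sqnorm_ge0. Qed.

Lemma bessel1 F k : L2 F -> mxnorm (fourier F k) ^+ 2 <= sqnorm F.
Proof.
move=> hF; apply: le_trans (bessel k.+1 hF); rewrite big_ord_recr /= lerDr.
by apply: sumr_ge0 => i _; exact: sqr_ge0.
Qed.

Definition mul_expi F : R -> 'cV[R[i]]_m := fun t => expi t *: F t.
Definition div_expi F : R -> 'cV[R[i]]_m := fun t => (expi t)^-1 *: F t.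

Lemma mul_expiK F : div_expi (mul_expi F) = F.
Proof. by apply/funext => t; rewrite /div_expi /mul_expi scalerA mulVf ?scale1r //
  expi_neq0. Qed.

Lemma L2_mul_expi F : L2 F -> L2 (mul_expi F).
Proof.
move=> /L2P hF; apply/L2P => k.
rewrite (_ : (fun t => _) = fun t => expi t * F t k 0).
  apply: (@square_integrable_bounded _ _ _ 1) => //; first exact: cmeasurable_expi.
  by apply: ae_circleT => t _; rewrite normc_expi.
by apply/funext => t; rewrite mxE.
Qed.

Lemma L2_div_expi F : L2 F -> L2 (div_expi F).
Proof.
move=> /L2P hF; apply/L2P => k.
rewrite (_ : (fun t => _) = fun t => Num.conj (expi t) * F t k 0).
  apply: (@square_integrable_bounded _ _ _ 1) => //.
    by apply: cmeasurable_conj; exact: cmeasurable_expi.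
  by apply: ae_circleT => t _; rewrite conj_expi normcV normc_expi invr1.
by apply/funext => t; rewrite mxE conj_expi.
Qed.

Lemma inner_div_expi F G : inner (div_expi F) G = inner F (mul_expi G).
Proof.
rewrite /inner; apply: circle_mean_eq => t _; apply: eq_bigr => k _.
by rewrite !mxE rmorphM /= conj_expi; ring.
Qed.

Lemma mul_expiB F G : mul_expi (F - G) = mul_expi F - mul_expi G.
Proof. by apply/funext => t; rewrite /mul_expi !fctE scalerBr. Qed.
Lemma div_expiB F G : div_expi (F - G) = div_expi F - div_expi G.
Proof. by apply/funext => t; rewrite /div_expi !fctE scalerBr. Qed.

Lemma sqnorm_div_expi F : sqnorm (div_expi F) = sqnorm F.
Proof.
apply: mean_eq => t _; rewrite !mxnorm_col; apply: eq_bigr => k _.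
by rewrite mxE sqmodM -(normc_sqmod (expi t)^-1) normcV normc_expi invr1 expr1n mul1r.
Qed.

Lemma sqnorm_mul_expi F : sqnorm (mul_expi F) = sqnorm F.
Proof. by rewrite -sqnorm_div_expi mul_expiK. Qed.

End FourierVec.

(** * Limits of analytic trigonometric polynomials *)

Section Analytic.
Context {R : realType} {m : nat}.
Local Notation D := (@angles R).
Implicit Types (F G K : R -> 'cV[R[i]]_m) (a b : R[i]) (v w : 'cV[R[i]]_m)
  (A B : nat -> 'cV[R[i]]_m).

(* [H2P] below identifies this with [H2 F]. *)
Definition analytic F : Prop :=
  L2 F /\ forall e : R, 0 < e -> exists A n, sqnorm (F - trigpoly A n) < e.

Lemma analytic_L2 F : analytic F -> L2 F. Proof. by case. Qed.

(** Bookkeeping for [sqnorm_tri] and [sqnormD_le]: two squared errors below e / 4 combine into one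
    below e. *)
Lemma lt_quarters (x y z e : R) :
  x <= 2 * y + 2 * z -> y < e / 4 -> z < e / 4 -> x < e.
Proof. lra. Qed.

Lemma analytic_lim F : L2 F ->
  (forall e : R, 0 < e -> exists G, analytic G /\ sqnorm (F - G) < e) -> analytic F.
Proof.
move=> hF h; split=> // e e0.
have e4 : 0 < e / 4 by rewrite divr_gt0.
have [G [[hG aG] FG]] := h _ e4; have [A [n GA]] := aG _ e4.
exists A, n; exact: lt_quarters (sqnorm_tri hF hG (L2_trigpoly A n)) FG GA.
Qed.

Lemma analytic_trigpoly A n : analytic (trigpoly A n).
Proof.
split; first exact: L2_trigpoly.
move=> e e0; exists A, n; rewrite subrr; apply: le_lt_trans e0.
by rewrite (sqnormE L2_0) (inner0l L2_0).
Qed.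

Lemma trigpolyD A B n : trigpoly (fun k => A k + B k) n = trigpoly A n + trigpoly B n.
Proof.
apply/funext => t; rewrite fctE /trigpoly -big_split /=; apply: eq_bigr => k _.
by rewrite scalerDr.
Qed.

Lemma trigpolyZ a A n : trigpoly (fun k => a *: A k) n = a *: trigpoly A n.
Proof.
apply/funext => t; rewrite fctE /trigpoly scaler_sumr; apply: eq_bigr => k _.
by rewrite !scalerA mulrC.
Qed.

(** Padding by zero coefficients, used to bring polynomials to a common or sufficient length. *)
Lemma trigpoly_cutoff A n N : (n <= N)%N ->
  trigpoly (fun k => if (k < n)%N then A k else 0) N = trigpoly A n.
Proof.
move=> nN; apply/funext => t; rewrite /trigpoly.
rewrite [RHS](big_ord_widen N (fun k => expi t ^+ k *: A k)) //.
rewrite [RHS]big_mkcond; apply: eq_bigr => k _; case: ifP => // _.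
by rewrite scaler0.
Qed.

Lemma trigpoly_add A B n k : exists C N, trigpoly A n + trigpoly B k = trigpoly C N.
Proof.
eexists; exists (maxn n k).
by rewrite -(trigpoly_cutoff A (leq_maxl n k)) -(trigpoly_cutoff B (leq_maxr n k))
  -trigpolyD.
Qed.

Lemma analyticD F G : analytic F -> analytic G -> analytic (F + G).
Proof.
move=> [hF aF] [hG aG]; split; first exact: L2D.
move=> e e0; have e4 : 0 < e / 4 by rewrite divr_gt0.
have [A [n FA]] := aF _ e4; have [B [k GB]] := aG _ e4.
have [C [N E]] := trigpoly_add A B n k; exists C, N; rewrite -E opprD addrACA.
exact: lt_quarters (sqnormD_le (L2B hF (L2_trigpoly A n)) (L2B hG (L2_trigpoly B
  k))) FA GB.
Qed.

Lemma analyticZ a F : analytic F -> analytic (a *: F).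
Proof.
move=> [hF aF]; split; first exact: L2Z.
move=> e e0; have s0 := sqmod_ge0 a.
(* Adding 1 to the denominator covers a = 0. *)
have e1 : 0 < e / (sqmod a + 1) by rewrite divr_gt0 // ltr_wpDl.
have [A [n FA]] := aF _ e1; exists (fun k => a *: A k), n.
rewrite trigpolyZ -scalerBr (sqnormZ _ (L2B hF (L2_trigpoly A n))).
apply: (@le_lt_trans _ _ (sqmod a * (e / (sqmod a + 1)))).
  by rewrite ler_wpM2l // ltW.
by rewrite mulrCA gtr_pMr // ltr_pdivrMr ?mul1r ?ltrDl // ltr_wpDl.
Qed.

Lemma analytic0 : analytic 0.
Proof.
by have := analytic_trigpoly (fun=> 0) 0; congr (analytic _); apply/funext => t;
  rewrite /trigpoly big_ord0.
Qed.

Lemma analyticB F G : analytic F -> analytic G -> analytic (F - G).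
Proof. by move=> hF hG; rewrite -scaleN1r; apply: (analyticD hF (analyticZ _ hG)). Qed.

Lemma analytic_sum (I : Type) (r : seq I) (F : I -> R -> 'cV[R[i]]_m) :
  (forall i, analytic (F i)) -> analytic (\sum_(i <- r) F i).
Proof.
by move=> h; elim/big_ind: _ => [|? ?|? _]; [exact: analytic0 | exact:
  analyticD | exact: h].
Qed.

Lemma analytic_mul_expi F : analytic F -> analytic (mul_expi F).
Proof.
move=> [hF aF]; split; first exact: L2_mul_expi.
move=> e e0; have [A [n FA]] := aF _ e0.
exists (fun k => if k is k'.+1 then A k' else 0), n.+1.
rewrite (_ : trigpoly _ _ = mul_expi (trigpoly A n));
  first by rewrite -mul_expiB sqnorm_mul_expi.
apply/funext => t; rewrite /trigpoly /mul_expi big_ord_recl scaler0 add0r scaler_sumr.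
by apply: eq_bigr => k _; rewrite lift0 exprS scalerA.
Qed.

Lemma analytic_mul_expiX F k : analytic F -> analytic (fun t => expi t ^+ k *: F t).
Proof.
elim: k => [|k ih] hF.
  by rewrite (_ : (fun t => _) = F) //; apply/funext => t; rewrite expr0 scale1r.
rewrite (_ : (fun t => _) = mul_expi (fun t => expi t ^+ k *: F t)).
  by apply: analytic_mul_expi; exact: ih.
by apply/funext => t; rewrite exprS -scalerA.
Qed.

Lemma sqnorm_bounded_mx (Phi : R -> 'M[R[i]]_m) F (c : R) :
  Linfty Phi -> L2 F -> (forall t, D t -> mxnorm (Phi t) ^+ 2 <= c) ->
  sqnorm (fun t => Phi t *m F t) <= c * sqnorm F.
Proof.
move=> hP hF hc; rewrite /sqnorm -(meanZ _ (L2_integrable_circle hF)); apply: mean_le.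
- exact: (L2_integrable_circle (Linfty_L2 hP hF)).
- exact: (integrable_circleZ _ (L2_integrable_circle hF)).
- move=> t Dt; apply: le_trans (mxnorm_mulmx _ _) _.
  by rewrite ler_wpM2r ?sqr_ge0 ?hc.
Qed.

Lemma Linfty_bounded (Phi : R -> 'M[R[i]]_m) (c : R) : measurable_circle Phi ->
  (forall t, D t -> mxnorm (Phi t) <= c) -> Linfty Phi.
Proof. by move=> mP h; split => //; exists c; apply: ae_circleT. Qed.

Lemma Linfty_cst (B : 'M[R[i]]_m) : Linfty (fun _ : R => B).
Proof.
by apply: (@Linfty_bounded _ (mxnorm B)) => // i j; exact: (cmeasurable_cst (B i j)).
Qed.

Lemma analytic_mx (B : 'M[R[i]]_m) F : analytic F -> analytic (fun t => B *m F t).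
Proof.
move=> [hF aF]; split; first exact: (Linfty_L2 (Linfty_cst B) hF).
move=> e e0; have s0 := sqr_ge0 (mxnorm B).
have e1 : 0 < e / (mxnorm B ^+ 2 + 1) by rewrite divr_gt0 // ltr_wpDl.
have [A [n FA]] := aF _ e1; exists (fun k => B *m A k), n.
rewrite (_ : _ - _ = fun t => B *m (F - trigpoly A n) t); last first.
  apply/funext => t; rewrite !fctE mulmxBr /trigpoly mulmx_sumr; congr (_ - _).
  by apply: eq_bigr => k _; rewrite scalemxAr.
apply: (@le_lt_trans _ _ (mxnorm B ^+ 2 * (e / (mxnorm B ^+ 2 + 1)))).
  apply: le_trans (sqnorm_bounded_mx (Linfty_cst B) (L2B hF (L2_trigpoly A n)) (fun
    t _ => lexx _)) _.
  by rewrite ler_wpM2l // ltW.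
by rewrite mulrCA gtr_pMr // ltr_pdivrMr ?mul1r ?ltrDl // ltr_wpDl.
Qed.

Lemma analytic_backward F : analytic F -> analytic (div_expi (F - fun=> fourier F 0)).
Proof.
move=> [hF aF]; split; first by apply: L2_div_expi; exact: (L2B hF (L2_cst _)).
move=> e e0; have e4 : 0 < e / 4 by rewrite divr_gt0.
have [A' [n' FA']] := aF _ e4.
(* Length [n.+1] guarantees a constant coefficient to subtract; padding by zero provides it even
   when the first approximation is empty. *)
have [A [n FA]] : exists A n, sqnorm (F - trigpoly A n.+1) < e / 4.
  by exists (fun k => if (k < n')%N then A' k else 0), n'; rewrite trigpoly_cutoff.
exists (fun k => A k.+1), n.
have -> : trigpoly (fun k => A k.+1) n = div_expi (trigpoly A n.+1 - fun=> A 0%N).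
  apply/funext => t; rewrite /div_expi !fctE /trigpoly big_ord_recl expr0 scale1r
    addrC addKr.
  rewrite scaler_sumr; apply: eq_bigr => k _.
  by rewrite lift0 scalerA exprS mulKf // expi_neq0.
rewrite -div_expiB sqnorm_div_expi.
(* Removing constant terms changes the error [P] by its own zeroth coefficient, which Bessel's
   inequality bounds by the error. *)
set P := F - trigpoly A n.+1.
have hP : L2 P := L2B hF (L2_trigpoly A n.+1).
have -> : F - (fun=> fourier F 0) - (trigpoly A n.+1 - fun=> A 0%N) = P - (fun=>
  fourier P 0).
  apply/funext => t; rewrite !fctE (fourierB _ hF (L2_trigpoly _ _))
    fourier_trigpoly /= opprB.
  by rewrite [A 0%N - _]addrC addrACA [- fourier F 0 + _]addrC /P !fctE opprB.
apply: (lt_quarters (sqnormD_le hP (L2N (L2_cst _))) FA).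
rewrite (sqnormN (L2_cst _)) sqnorm_cst; apply: le_lt_trans FA; exact: bessel1.
Qed.

Lemma le_epsilon0 (x c : R) : 0 <= c -> (forall e, 0 < e -> x <= c * e) -> x <= 0.
Proof.
move=> c0 h; rewrite leNgt; apply/negP => x0.
have e0 : 0 < x / (2 * (c + 1)) by rewrite divr_gt0 // mulr_gt0 // ltr_wpDl.
have := h _ e0; rewrite leNgt => /negP; apply.
rewrite mulrCA gtr_pMr // ltr_pdivrMr; last by rewrite mulr_gt0 // ltr_wpDl.
lra.
Qed.

(** Subtracting a polynomial from K does not change <F, K>, and Cauchy-Schwarz makes the pairing
    with the remainder arbitrarily small. *)
Lemma analytic_ortho F K : L2 F -> analytic K ->
  (forall k v, inner F (monomial k v) = 0) ->
  inner F K = 0.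
Proof.
move=> hF [hK aK] h.
apply: sqmod_le0.
apply: (le_epsilon0 (sqnorm_ge0 F)) => e e0; have [A [n KA]] := aK _ e0.
have -> : inner F K = inner F (K - trigpoly A n).
  rewrite (innerBr hF hK (L2_trigpoly A n)) (inner_trigpoly _ _ hF) big1 ?subr0 //
    => k _.
  by rewrite -inner_fourier.
apply: le_trans (cauchy_schwarz hF (L2B hK (L2_trigpoly A n))) _.
by rewrite ler_wpM2l ?sqnorm_ge0 // ltW.
Qed.

(** The function e^{-it} v has frequency -1: moving e^{it} across the product pairs frequency 0 with
    k + 1. This is why the term F(0) of the backward shift disappears in products with H^2. *)
Lemma inner_div_expi_cst v K : analytic K -> inner (div_expi (fun=> v)) K = 0.
Proof.
move=> aK; apply: (analytic_ortho (L2_div_expi (L2_cst v)) aK) => k w.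
rewrite inner_div_expi.
have -> : mul_expi (monomial k w) = monomial k.+1 w.
  by apply/funext => t; rewrite /mul_expi /monomial scalerA -exprS.
have -> : (fun _ : R => v) = monomial 0 v.
  by apply/funext => t; rewrite /monomial expr0 scale1r.
by rewrite inner_monomial mul0r.
Qed.

End Analytic.

(** * Power series on the disc *)

Section PowerSeries.
Context {R : realType} {p q : nat}.
Implicit Types (M : 'M[R[i]]_(p, q)) (z : R[i]) (A : nat -> 'M[R[i]]_(p, q)).

(** Entrywise l^1 norm: its triangle inequality reduces at once to that of [normc]. It is equivalent
    to [mxnorm] by [mxnorm_le1] and [mxnorm1_le], so convergence may be measured in either. *)
Definition mxnorm1 M : R := \sum_i \sum_j normc (M i j).

Lemma mxnorm1_ge0 M : 0 <= mxnorm1 M.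
Proof. by do 2 (apply: sumr_ge0 => ? _); exact: normc_ge0. Qed.

Lemma mxnorm1D M M' : mxnorm1 (M + M') <= mxnorm1 M + mxnorm1 M'.
Proof.
rewrite /mxnorm1 -big_split; apply: ler_sum => i _; rewrite -big_split.
by apply: ler_sum => j _; rewrite mxE; exact: le_normcD.
Qed.

Lemma mxnorm1Z z M : mxnorm1 (z *: M) = normc z * mxnorm1 M.
Proof.
rewrite /mxnorm1 mulr_sumr; apply: eq_bigr => i _; rewrite mulr_sumr.
by apply: eq_bigr => j _; rewrite mxE normcM.
Qed.

Lemma mxnorm1N M : mxnorm1 (- M) = mxnorm1 M.
Proof. by do 2 (apply: eq_bigr => ? _); rewrite mxE normcN. Qed.

Lemma mxnorm1_sum (I : Type) (s : seq I) (P : pred I) (F : I -> 'M[R[i]]_(p, q)) :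
  mxnorm1 (\sum_(k <- s | P k) F k) <= \sum_(k <- s | P k) mxnorm1 (F k).
Proof.
elim/big_ind2: _ => [|x a y b xa yb|//].
  by rewrite /mxnorm1 big1 // => i _; rewrite big1 // => j _; rewrite mxE normc0.
by apply: le_trans (mxnorm1D _ _) _; exact: lerD.
Qed.

Lemma sum_sqr_le (I : finType) (a : I -> R) : (forall k, 0 <= a k) ->
  \sum_k a k ^+ 2 <= (\sum_k a k) ^+ 2.
Proof.
move=> a0; rewrite expr2 mulr_suml; apply: ler_sum => k _; rewrite expr2 ler_wpM2l //.
by rewrite (bigD1 k) //= lerDl sumr_ge0.
Qed.

Lemma mxnorm_le1 M : mxnorm M <= mxnorm1 M.
Proof.
rewrite -ler_sqr ?nnegrE ?mxnorm_ge0 ?mxnorm1_ge0 // mxnorm_sq.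
apply: le_trans (sum_sqr_le _); last by move=> i; apply: sumr_ge0 => j _; exact:
  normc_ge0.
apply: ler_sum => i _; apply: le_trans (sum_sqr_le _); last by move=> j; exact:
  normc_ge0.
by apply: ler_sum => j _; rewrite normc_sqmod.
Qed.

Lemma mxnorm1_le M : mxnorm1 M <= (p * q)%:R * mxnorm M.
Proof.
apply: (@le_trans _ _ (\sum_(i < p) \sum_(j < q) mxnorm M)).
  by do 2 (apply: ler_sum => ? _); exact: normc_le_mxnorm.
by rewrite !sumr_const !card_ord -mulrnA mulr_natl mulnC.
Qed.

Definition psum A z n : 'M[R[i]]_(p, q) := \sum_(k < n) z ^+ k *: A k.

Lemma power_seriesP A f z (e : R) : power_series_on_disc A f -> normc z < 1 -> 0 < e ->
  exists N, forall n, (N <= n)%N -> mxnorm1 (f z - psum A z n) < e.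
Proof.
move=> hA z1 e0; have := hA z z1.
(* Adding 1 covers empty matrices, for which p * q = 0. *)
have e1 : 0 < e / ((p * q)%:R + 1) by rewrite divr_gt0 // ltr_wpDl.
move=> /cvgr0Pnorm_lt /(_ _ e1) [N _ hN]; exists N => n Nn.
apply: le_lt_trans (mxnorm1_le _) _.
have := hN n Nn; rewrite /= ger0_norm ?mxnorm_ge0 // ltr_pdivlMr ?ltr_wpDl //.
rewrite mulrC; apply: le_lt_trans.
by rewrite ler_wpM2r ?mxnorm_ge0 // lerDl.
Qed.

Lemma psum_sub A z n k : (n <= k)%N ->
  psum A z k - psum A z n = \sum_(n <= l < k) z ^+ l *: A l.
Proof.
move=> nk; rewrite /psum -!(big_mkord xpredT (fun l => z ^+ l *: A l)).
by rewrite (big_cat_nat (leq0n n) nk) /= addrAC subrr add0r.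
Qed.

Lemma geom_tail (x : R) n k : 0 <= x -> x < 1 ->
  \sum_(n <= l < k) x ^+ l <= x ^+ n / (1 - x).
Proof.
move=> x0 x1; have x1' : 0 < 1 - x by rewrite subr_gt0.
rewrite ler_pdivlMr //.
have [kn|nk] := leqP k n.
  by rewrite big_geq // mul0r exprn_ge0.
suff : (\sum_(n <= l < k) x ^+ l) * (1 - x) = x ^+ n - x ^+ k.
  by move=> ->; rewrite gerBl exprn_ge0.
rewrite mulr_suml.
under eq_bigr do rewrite mulrBr mulr1 -exprSr.
have -> : \sum_(n <= l < k) (x ^+ l - x ^+ l.+1) = - \sum_(n <= l < k) (x ^+ l.+1 -
  x ^+ l).
  by rewrite -sumrN; apply: eq_bigr => l _; rewrite opprB.
by rewrite telescope_sumr ?opprB // ltnW.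
Qed.

(* Comparison with the geometric series of ratio [r / r'], [r' = (1 + r) / 2]:
   the terms of the series are bounded at [r']. *)
Lemma power_series_uniform A f (r e : R) : power_series_on_disc A f ->
  0 <= r -> r < 1 -> 0 < e ->
  exists N, forall n, (N <= n)%N -> forall z, normc z <= r ->
    mxnorm (f z - psum A z n) <= e.
Proof.
move=> hA r0 r1 e0; set s := (1 + r) / 2.
have s0 : 0 < s by rewrite divr_gt0 // ltr_wpDr.
have s1 : s < 1 by rewrite ltr_pdivrMr // mul1r; lra.
have rs : r < s by rewrite ltr_pdivlMr //; lra.
have ns : normc s%:C = s by rewrite normc_real gtr0_norm.
have ns1 : normc s%:C < 1 by rewrite ns.
have [N0 hN0] := power_seriesP hA ns1 ltr01.
(* A term is the difference of two consecutive partial sums, each within 1 of the value of [f] at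
   [s]. *)
have hb l : (N0 <= l)%N -> s ^+ l * mxnorm1 (A l) <= 2.
  move=> hl; have -> : s ^+ l * mxnorm1 (A l) = mxnorm1 (s%:C ^+ l *: A l).
    by rewrite mxnorm1Z normcX ns.
  have -> : s%:C ^+ l *: A l = (f s%:C - psum A s%:C l) - (f s%:C - psum A s%:C l.+1).
    by rewrite /psum big_ord_recr /= opprB addrA [_ - _ + (_ + _)]addrA subrK addrC
      addKr.
  apply: le_trans (mxnorm1D _ _) _; rewrite mxnorm1N.
  have h1 := hN0 l hl; have h2 := hN0 l.+1 (leqW hl); lra.
set x := r / s.
have x0 : 0 <= x by rewrite divr_ge0 // ltW.
have x1 : x < 1 by rewrite ltr_pdivrMr // mul1r.
have c0 : 0 < e * (1 - x) / 4 by rewrite divr_gt0 // mulr_gt0 // subr_gt0.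
have : (fun n => x ^+ n) @ \oo --> (0 : R) by apply: cvg_expr; rewrite ger0_norm.
move=> /cvgr0Pnorm_lt /(_ _ c0) [N1 _ hN1].
exists (maxn N0 N1) => n; rewrite geq_max => /andP[hn0 hn1] z zr.
have z1 : normc z < 1 by apply: le_lt_trans zr _.
have e2 : 0 < e / 2 by rewrite divr_gt0.
have [N2 hN2] := power_seriesP hA z1 e2.
(* [k] depends on [z] through [N2], but the threshold on [n] does not: the geometric bound on the
   block from [n] to [k] is uniform in both [z] and [k]. *)
set k := maxn n N2.
have nk : (n <= k)%N by exact: leq_maxl.
apply: le_trans (mxnorm_le1 _) _.
have -> : f z - psum A z n = (f z - psum A z k) + (psum A z k - psum A z n).
  by rewrite addrA subrK.
apply: le_trans (mxnorm1D _ _) _.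
have h1 : mxnorm1 (f z - psum A z k) < e / 2 by apply: hN2; exact: leq_maxr.
suff h2 : mxnorm1 (psum A z k - psum A z n) <= e / 2 by lra.
rewrite psum_sub //; apply: le_trans (mxnorm1_sum _ _ _) _.
apply: (@le_trans _ _ (\sum_(n <= l < k) 2 * x ^+ l)).
  rewrite big_nat_cond [leRHS]big_nat_cond; apply: ler_sum => l /andP[/andP[nl _] _].
  rewrite mxnorm1Z normcX.
  apply: (@le_trans _ _ (r ^+ l * mxnorm1 (A l))).
    by rewrite ler_wpM2r ?mxnorm1_ge0 // lerXn2r ?nnegrE ?normc_ge0.
  have -> : r ^+ l = x ^+ l * s ^+ l by rewrite -exprMn /x divfK // gt_eqF.
  rewrite -mulrA mulrC ler_wpM2r ?exprn_ge0 // hb //; exact: leq_trans nl.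
rewrite -mulr_sumr; have := geom_tail n k x0 x1.
have : x ^+ n <= e * (1 - x) / 4.
  by have := hN1 n hn1; rewrite /= ger0_norm ?exprn_ge0 // => /ltW.
move=> h3 h4.
have : x ^+ n / (1 - x) <= e / 4.
  rewrite ler_pdivrMr ?subr_gt0 //; apply: le_trans h3 _.
  by rewrite mulrAC.
by lra.
Qed.

Lemma power_series_cmeasurable A f (r : R) : power_series_on_disc A f ->
  0 <= r -> r < 1 ->
  forall i j, cmeasurable (fun t => f (r%:C * expi t) i j).
Proof.
move=> hA r0 r1 i j.
have nz t : normc (r%:C * expi t) = r.
  by rewrite normcM normc_expi mulr1 normc_real ger0_norm.
have mS n : cmeasurable (fun t => psum A (r%:C * expi t) n i j).
  rewrite (_ : (fun t => _) = fun t => \sum_(k < n) ((r%:C * expi t) ^+ k * A k i j)).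
    apply: cmeasurable_sum => k; apply: cmeasurableM; last exact: cmeasurable_cst.
    under eq_fun do rewrite exprMn.
    by apply: cmeasurableM; [exact: cmeasurable_cst | exact: cmeasurable_expiX].
  by apply/funext => t; rewrite /psum summxE; apply: eq_bigr => k _; rewrite mxE.
(* [g] stands for the real or the imaginary part, so that measurability passes to the limit of a
   real sequence. *)
have key (g : R[i] -> R) : (forall z, `|g z| <= normc z) ->
  (forall z w, g (z - w) = g z - g w) ->
    (forall n, measurable_fun angles (fun t => g (psum A (r%:C * expi t) n i j))) ->
    measurable_fun angles (fun t => g (f (r%:C * expi t) i j)).
  move=> g1 gB mg.
  apply: (@measurable_fun_cvg _ _ _ angles (fun n t =>
    g (psum A (r%:C * expi t) n i j))) => //.
  move=> t _; apply/cvgrPdist_lt => e e0.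
  have z1 : normc (r%:C * expi t) < 1 by rewrite nz.
  have [N hN] := power_seriesP hA z1 e0.
  exists N => // n /= Nn; rewrite -gB; apply: le_lt_trans (g1 _) _.
  apply: le_lt_trans (hN n Nn).
  have -> : f (r%:C * expi t) i j - psum A (r%:C * expi t) n i j =
    (f (r%:C * expi t) - psum A (r%:C * expi t) n) i j by rewrite !mxE.
  by apply: le_trans (normc_le_mxnorm _ _ _) _; exact: mxnorm_le1.
split; apply: (key _ _ _) => //.
- exact: normr_Re_le.
- by move=> [a b] [c d].
- by move=> n; case: (mS n).
- exact: normr_Im_le.
- by move=> [a b] [c d].
- by move=> n; case: (mS n).
Qed.

End PowerSeries.

(** * The Hardy space *)

Section HardySpace.
Context {R : realType} {m : nat}.
Local Notation Re := (@complex.Re R).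
Local Notation Im := (@complex.Im R).
Implicit Types (F G K : R -> 'cV[R[i]]_m) (a b : R[i]) (v w : 'cV[R[i]]_m)
  (A B : nat -> 'cV[R[i]]_m) (f : R[i] -> 'cV[R[i]]_m).

Lemma L2_bounded F (c : R) : measurable_circle F ->
  (forall t, mxnorm (F t) ^+ 2 <= c) -> L2 F /\ sqnorm F <= c.
Proof.
move=> mF h; have hF : L2 F.
  apply/L2P => k; split; first exact: mF.
  apply: integrable_circle_le (integrable_circle_cst c).
    by apply: (@measurable_sqmod _ (fun t => F t k 0)); exact: mF.
  move=> t _ /=; rewrite ger0_norm ?sqmod_ge0 //; apply: le_trans (h t).
  rewrite mxnorm_col (bigD1 k) //= lerDl.
  by apply: sumr_ge0 => i _; exact: sqmod_ge0.
split => //; rewrite -(mean_cst c); apply: mean_le; [exact: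
  L2_integrable_circle|exact: integrable_circle_cst|].
by move=> t _.
Qed.

Lemma psum_trigpoly A (r t : R) n :
  psum A (r%:C * expi t) n = trigpoly (fun k => r%:C ^+ k *: A k) n t.
Proof.
by apply: eq_bigr => k _; rewrite scalerA exprMn mulrC.
Qed.

(** On the circle of radius r < 1 the partial sums converge uniformly, hence in mean square;
    transported to the unit circle they are polynomials with coefficients r^k A_k. *)
Lemma hardy_dilate A f (r e : R) : power_series_on_disc A f ->
  0 <= r -> r < 1 -> 0 < e ->
  L2 (fun t => f (r%:C * expi t)) /\
  exists N, forall n, (N <= n)%N ->
    sqnorm ((fun t => f (r%:C * expi t)) - trigpoly (fun k => r%:C ^+ k *: A k) n) <= e.
Proof.
move=> hA r0 r1 e0.
have s0 : 0 < Num.sqrt e by rewrite sqrtr_gt0.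
have [N hN] := power_series_uniform hA r0 r1 s0.
have key n : (N <= n)%N ->
  L2 ((fun t => f (r%:C * expi t)) - trigpoly (fun k => r%:C ^+ k *: A k) n) /\
  sqnorm ((fun t => f (r%:C * expi t)) - trigpoly (fun k => r%:C ^+ k *: A k) n) <= e.
  move=> Nn; apply: L2_bounded.
    move=> i j; rewrite (_ : (fun t => complex.Re _) = Re \o (fun t =>
      f (r%:C * expi t) i j +
        (-1) * trigpoly (fun k => r%:C ^+ k *: A k) n t i j)); last first.
      by apply/funext => t; rewrite /= fctE !mxE mulN1r.
    rewrite (_ : (fun t => complex.Im _) = Im \o (fun t => f (r%:C * expi t) i j +
        (-1) * trigpoly (fun k => r%:C ^+ k *: A k) n t i j)); last first.
      by apply/funext => t; rewrite /= fctE !mxE mulN1r.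
    apply: cmeasurableD; first exact: (power_series_cmeasurable hA).
    apply: cmeasurableM; first exact: cmeasurable_cst.
    by rewrite (ord1 j); apply: L2_cmeasurable; exact: L2_trigpoly.
  move=> t; rewrite -(sqr_sqrtr (ltW e0)).
  rewrite (_ : (_ - _) t = f (r%:C * expi t) - psum A (r%:C * expi t) n); last first.
    by rewrite psum_trigpoly.
  rewrite lerXn2r ?nnegrE ?mxnorm_ge0 ?sqrtr_ge0 //; apply: hN => //.
  by rewrite normcM normc_expi mulr1 normc_real ger0_norm.
split; last by exists N => n /key [].
have [h _] := key N (leqnn _).
by have := L2D h (L2_trigpoly (fun k => r%:C ^+ k *: A k) N); rewrite subrK.
Qed.

Lemma mxnorm1_eq0 p q (M : 'M[R[i]]_(p, q)) : mxnorm1 M = 0 -> M = 0.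
Proof.
move=> h; apply: mxnorm_eq0; apply/eqP; rewrite eq_le mxnorm_ge0 andbT -h.
exact: mxnorm_le1.
Qed.

Lemma power_series_at0 p q (A : nat -> 'M[R[i]]_(p, q))
    (g : R[i] -> 'M[R[i]]_(p, q)) : power_series_on_disc A g -> g 0 = A 0%N.
Proof.
move=> hA; apply/eqP; rewrite -subr_eq0; apply/eqP/mxnorm1_eq0.
apply/eqP; rewrite eq_le mxnorm1_ge0 andbT.
apply: (@le_epsilon0 _ _ 1) => // e e0; rewrite mul1r.
have z1 : normc (0 : R[i]) < 1 by rewrite normc0.
have [N hN] := power_seriesP hA z1 e0.
have := hN N.+1 (leqnSn N); rewrite /psum big_ord_recl expr0 scale1r big1 ?addr0.
  exact: ltW.
by move=> k _; rewrite lift0 exprS mul0r scale0r.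
Qed.

(** Recording the constant coefficient lets the same approximation prove both that F is [analytic]
    and that f(0) is the zeroth Fourier coefficient of F. *)
Lemma hardy_extension_approx F f (e : R) : L2 F -> hardy_extension F f -> 0 < e ->
  exists A n, A 0%N = f 0 /\ sqnorm (F - trigpoly A n.+1) < e.
Proof.
move=> hF [[A _ hA] /fine_cvgP [_ h]] e0.
have e4 : 0 < e / 4 by rewrite divr_gt0.
(* [hardy_dilate] gives a non-strict bound; e / 8 leaves room for the strict e / 4. *)
have e8 : 0 < e / 8 by rewrite divr_gt0.
have [r [r0 r1 hr]] : exists r : R, [/\ 0 < r, r < 1 &
    fine (L2sqnorm (fun t => f (r%:C * expi t) - F t)) < e / 4].
  move/cvgr0Pnorm_lt : h => /(_ _ e4) h.
  have h2 := nbhs_left_lt (1 : R); have h3 := nbhs_left_gt (@ltr01 R).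
  have [r [[hr1 hr2] hr3]] := filter_ex (filterI (filterI h2 h3) h).
  by exists r; split => //; apply: le_lt_trans hr3; exact: ler_norm.
have [hL [N hN]] := hardy_dilate hA (ltW r0) r1 e8.
exists (fun k => r%:C ^+ k *: A k), N; split.
  by rewrite expr0 scale1r -(power_series_at0 hA).
rewrite (L2sqnormE (L2B hL hF)) /= in hr.
have h1 : sqnorm ((fun t => f (r%:C * expi t)) - trigpoly (fun k => r%:C ^+ k *:
  A k) N.+1) < e / 4.
  by apply: le_lt_trans (hN _ (leqnSn N)) _; lra.
apply: lt_quarters (sqnorm_tri hF hL (L2_trigpoly _ _)) _ h1.
by rewrite (sqnormBC hF hL).
Qed.

Lemma H2_analytic F : H2 F -> analytic F.
Proof.
move=> [hF [f hf]]; split=> // e e0.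
by have [A [n [_ h]]] := hardy_extension_approx hF hf e0; exists A, n.+1.
Qed.

(** Every extension has the same value at the centre, so the arbitrary choice inside [at0] is
    harmless. The difference is the zeroth coefficient of an approximation error, small by
    [bessel1]. *)
Lemma hardy_extension_at0 F f : L2 F -> hardy_extension F f -> f 0 = fourier F 0.
Proof.
move=> hF hf; apply/eqP; rewrite eq_sym -subr_eq0; apply/eqP/mxnorm_eq0.
suff : mxnorm (fourier F 0 - f 0) ^+ 2 <= 0.
  by rewrite le_eqVlt ltNge sqr_ge0 orbF sqrf_eq0 => /eqP.
apply: (@le_epsilon0 _ _ 1) => // e e0; rewrite mul1r.
have [A [n [A0 h]]] := hardy_extension_approx hF hf e0.
have -> : fourier F 0 - f 0 = fourier (F - trigpoly A n.+1) 0 by rewrite (fourierB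
  _ hF (L2_trigpoly _ _)) fourier_trigpoly -A0.
exact: le_trans (bessel1 _ (L2B hF (L2_trigpoly _ _))) (ltW h).
Qed.

Lemma H2_at0 F : H2 F -> at0 F = fourier F 0.
Proof.
move=> [hF [f hf]]; rewrite /at0; case: xgetP => [g _ hg|/(_ f)/(_ hf)//].
exact: (hardy_extension_at0 hF hg).
Qed.

Lemma is_cvg_power_series (c : nat -> R[i]) (C : R) z : (forall k, normc (c k) <= C) ->
  normc z < 1 -> exists s : R[i], forall e, 0 < e -> exists N, forall n, (N <= n)%N ->
    normc (s - \sum_(k < n) z ^+ k * c k) < e.
Proof.
move=> hC z1.
have key (g : R[i] -> R) : (forall z, `|g z| <= normc z) ->
    cvgn (series (fun k => g (z ^+ k * c k))).
  move=> g1; apply: normed_cvg.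
  apply: (@series_le_cvg _ _ (geometric C (normc z))).
  - by move=> n; exact: normr_ge0.
  - move=> n; rewrite /geometric /= mulr_ge0 ?exprn_ge0 ?normc_ge0 //.
    by apply: le_trans (hC 0%N); exact: normc_ge0.
  - move=> n; apply: le_trans (g1 _) _; rewrite normcM normcX /geometric /= mulrC.
    by rewrite ler_wpM2r ?exprn_ge0 ?normc_ge0.
  - by apply: is_cvg_geometric_series; rewrite ger0_norm ?normc_ge0.
have cR := key _ normr_Re_le; have cI := key _ normr_Im_le.
exists (limn (series (fun k => Re (z ^+ k * c k))) +i* limn (series (fun k =>
  Im (z ^+ k * c k)))).
move=> e e0; have e2 : 0 < e / 2 by rewrite divr_gt0.
move/cvgrPdist_lt : cR => /(_ _ e2) [N1 _ h1].
move/cvgrPdist_lt : cI => /(_ _ e2) [N2 _ h2].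
exists (maxn N1 N2) => n; rewrite geq_max => /andP[/h1 {}h1 /h2 {}h2].
have nle (x y : R) : normc (x +i* y) <= `|x| + `|y|.
  have -> : x +i* y = x%:C + (0 +i* y) by apply: complex_ext; rewrite /= ?addr0 ?add0r.
  apply: le_trans (le_normcD _ _) _; rewrite normc_real lerD2l.
  by rewrite /normc expr0n add0r sqrtr_sqr.
set s := _ - _.
have -> : s = Re s +i* Im s by case: s.
apply: le_lt_trans (nle _ _) _; rewrite (splitr e); apply: ltrD.
- move: h1; rewrite /series /= big_mkord /s cReD /=; congr (_ < _); congr (`|_ + _|).
  have -> (w : R[i]) : Re (- w) = - Re w by case: w.
  by congr (- _); elim/big_ind2: _ => // ? x ? y -> ->; rewrite cReD.
- move: h2; rewrite /series /= big_mkord /s cImD /=; congr (_ < _); congr (`|_ + _|).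
  have -> (w : R[i]) : Im (- w) = - Im w by case: w.
  by congr (- _); elim/big_ind2: _ => // ? x ? y -> ->; rewrite cImD.
Qed.

Lemma exists_power_series A (C : R) : (forall k, mxnorm (A k) <= C) ->
  exists f, power_series_on_disc A f.
Proof.
move=> hC.
have key (z : R[i]) : exists s : 'cV[R[i]]_m, normc z < 1 ->
    forall e, 0 < e -> exists N, forall n, (N <= n)%N ->
    mxnorm1 (s - psum A z n) < e.
  have [z1|] := boolP (normc z < 1); last by exists 0.
  have hj (j : 'I_m) := is_cvg_power_series (c := fun k => A k j 0)
    (fun k => le_trans (normc_le_mxnorm (A k) j 0) (hC k)) z1.
  have [s hs] := choice hj.
  exists (\col_j s j) => _ e e0.
  (* The denominator [m.+1] is nonzero, and m errors of this size still add up to strictly less than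
     e. *)
  have e1 : 0 < e / m.+1%:R by rewrite divr_gt0.
  have [N hN] := choice (fun j => hs j _ e1).
  exists (\max_j N j) => n Nn; rewrite /mxnorm1.
  apply: (@le_lt_trans _ _ (\sum_(j < m) e / m.+1%:R)).
    apply: ler_sum => j _; rewrite big_ord1 !mxE summxE.
    have -> : \sum_(k < n) (z ^+ k *: A k) j 0 = \sum_(k < n) z ^+ k * A k j 0.
      by apply: eq_bigr => k _; rewrite mxE.
    by apply/ltW/hN; apply: leq_trans Nn; exact: leq_bigmax.
  rewrite sumr_const card_ord -(mulr_natr (e / _)) -mulrA gtr_pMr //
    mulrC ltr_pdivrMr //.
  by rewrite mul1r ltr_nat.
have [f hf] := choice key.
exists f => z z1; apply/cvgr0Pnorm_lt => e e0.
have [N hN] := hf z z1 e e0; exists N => // n /= Nn.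
rewrite ger0_norm ?mxnorm_ge0 //; apply: le_lt_trans (hN n Nn); exact: mxnorm_le1.
Qed.

(** The monomials are orthogonal and the factors r^k are at most 1, so dilation only shrinks a
    difference of polynomials. The bound is uniform in r. *)
Lemma dilate_fourier_diff A B (r : R) n : 0 <= r -> r <= 1 ->
  sqnorm (trigpoly (fun k => r%:C ^+ k *: A k) n - trigpoly (fun k => r%:C ^+ k *:
    B k) n) <=
  \sum_(k < n) mxnorm (A k - B k) ^+ 2.
Proof.
move=> r0 r1.
have -> : trigpoly (fun k => r%:C ^+ k *: A k) n - trigpoly (fun k => r%:C ^+ k *:
  B k) n =
    trigpoly (fun k => r%:C ^+ k *: (A k - B k)) n.
  apply/funext => t; rewrite !fctE /trigpoly -sumrB; apply: eq_bigr => k _.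
  by rewrite -scalerBr -scalerBr.
rewrite sqnorm_trigpoly; apply: ler_sum => k _.
rewrite !mxnorm_col; apply: ler_sum => j _.
rewrite !mxE sqmodM -normc_sqmod normcX normc_real ger0_norm // -exprM.
by rewrite ler_piMl ?sqmod_ge0 // exprn_ile1.
Qed.

(** The extension f is the power series of the Fourier coefficients A of F. With a polynomial B
    close to F, the distance from f(r e^{it}) to F is split along f_r, A_r, B_r, B, F, where the
    subscript denotes dilation and A is truncated. The gap from A_r to B_r is controlled by Bessel
    uniformly in r; only the gap from B_r to B requires r to be near 1, and it is a finite sum. *)
Lemma analytic_H2 F : analytic F -> H2 F.
Proof.
move=> [hF aF]; split => //; pose A := fourier F.
have A1 k : mxnorm (A k) <= Num.sqrt (sqnorm F).
  rewrite -ler_sqr ?nnegrE ?mxnorm_ge0 ?sqrtr_ge0 // (sqr_sqrtr (sqnorm_ge0 F)).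
  exact: bessel1.
have [f hA] := exists_power_series A1.
exists f; split.
  exists A => //.
  apply: (@le_lt_trans _ _ (sqnorm F)%:E); last exact: ltry.
  apply: lime_le.
    by apply: is_cvg_nneseries => n _ _; rewrite lee_fin sqr_ge0.
  apply: nearW => n /=; rewrite big_mkord sumEFin lee_fin; exact: bessel.
apply/fine_cvgP; split.
  have h2 := nbhs_left_lt (1 : R); have h3 := nbhs_left_gt (@ltr01 R).
  near=> r.
  have r0 : 0 <= r by apply: ltW; near: r.
  have r1 : r < 1 by near: r.
  have [hL _] := hardy_dilate hA r0 r1 ltr01.
  by rewrite (L2sqnormE (L2B hL hF)).
apply/cvgr0Pnorm_lt => e e0.
(* The four gaps are joined by two levels of [sqnorm_tri], each costing a factor 4. *)
have e16 : 0 < e / 4 / 4 by rewrite !divr_gt0.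
have e32 : 0 < e / 4 / 4 / 2 by rewrite divr_gt0.
have e3216 : e / 4 / 4 / 2 < e / 4 / 4 by rewrite ltr_pdivrMr // ltr_pMr // ltr1n.
have [B' [n FB']] := aF _ e16.
pose B k := if (k < n)%N then B' k else 0.
have FB N : (n <= N)%N -> sqnorm (F - trigpoly B N) < e / 4 / 4 by move=> nN;
  rewrite trigpoly_cutoff.
(* This sum is the squared distance from B to its dilation, once [N] is the length of B. *)
have hc N : (fun r : R => \sum_(k < N) (1 - r ^+ k) ^+ 2 * mxnorm (B k) ^+ 2) @
  1^'- --> (0 : R).
  elim: N => [|N ih].
    by under eq_fun do rewrite big_ord0; exact: cvg_cst.
  have h1 : (fun r : R => (1 - r ^+ N) ^+ 2) @ 1^'- --> (0 : R).
    apply: cvg_at_left_filter.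
    have -> : 0 = (1 - 1 ^+ N) ^+ 2 :> R by rewrite expr1n subrr expr0n.
    apply: (@continuous_comp _ _ _ (fun r : R => 1 - r ^+ N) (fun x => x ^+ 2)).
      by apply: cvgB; [exact: cvg_cst|exact: exprn_continuous].
    exact: exprn_continuous.
  rewrite (_ : (fun r : R => _) = fun r : R =>
    \sum_(k < N) (1 - r ^+ k) ^+ 2 * mxnorm (B k) ^+ 2 +
    (1 - r ^+ N) ^+ 2 * mxnorm (B N) ^+ 2); last first.
    by apply/funext => r; rewrite big_ord_recr.
  have h2 : (fun r : R => (1 - r ^+ N) ^+ 2 * mxnorm (B N) ^+ 2) @ 1^'- --> (0 : R).
    rewrite -(mul0r (mxnorm (B N) ^+ 2)); apply: cvgM => //; exact: cvg_cst.
  suff: (fun r : R => \sum_(k < N) (1 - r ^+ k) ^+ 2 * mxnorm (B k) ^+ 2 +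
    (1 - r ^+ N) ^+ 2 * mxnorm (B N) ^+ 2) @ 1^'- --> (0 + 0 : R) by rewrite addr0.
  exact: cvgD.
move/cvgr0Pnorm_lt : (hc n) => /(_ _ e16) {}hc.
have h2 := nbhs_left_lt (1 : R); have h3 := nbhs_left_gt (@ltr01 R).
near=> r.
have r0 : 0 <= r by apply: ltW; near: r.
have r1 : r < 1 by near: r.
have hr : `|\sum_(k < n) (1 - r ^+ k) ^+ 2 * mxnorm (B k) ^+ 2| < e / 4 / 4 by near: r.
have [hL [N hN]] := hardy_dilate hA r0 r1 e32.
(* The common length must reach [n], so that the padded B still approximates F, and [N], which
   depends on r, so that truncating f_r costs little. *)
have l1 := le_lt_trans (hN _ (leq_maxr n N)) e3216; set M := maxn n N in l1.
have nM : (n <= M)%N := leq_maxl _ _.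
have -> : (fine \o (fun s : R => L2sqnorm (fun t => f (s%:C * expi t) - F t))) r =
    sqnorm ((fun t => f (r%:C * expi t)) - F).
  exact: (congr1 fine (L2sqnormE (L2B hL hF))).
rewrite ger0_norm ?sqnorm_ge0 //.
set fr := fun t => f (r%:C * expi t) in l1 hL *.
set rA := trigpoly _ M in l1; set rB := trigpoly (fun k => r%:C ^+ k *: B k) M.
have l2 : sqnorm (rA - rB) < e / 4 / 4.
  apply: le_lt_trans (dilate_fourier_diff _ _ _ r0 (ltW r1)) _.
  have -> : \sum_(k < M) mxnorm (A k - B k) ^+ 2 =
            \sum_(k < M) mxnorm (fourier (F - trigpoly B M) k) ^+ 2.
    by apply: eq_bigr => k _; rewrite (fourierB _ hF (L2_trigpoly _ _))
      fourier_trigpoly ltn_ord.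
  exact: le_lt_trans (bessel _ (L2B hF (L2_trigpoly _ _))) (FB _ nM).
have l3 : sqnorm (rB - trigpoly B M) < e / 4 / 4.
  have -> : rB - trigpoly B M = trigpoly (fun k => (r%:C ^+ k - 1) *: B k) M.
    apply/funext => t; rewrite !fctE /rB /trigpoly -sumrB; apply: eq_bigr => k _.
    by rewrite -scalerBr scalerBl scale1r.
  rewrite sqnorm_trigpoly; apply: le_lt_trans hr; apply: le_trans (ler_norm _).
  rewrite [leRHS](big_ord_widen M (fun k => (1 - r ^+ k) ^+ 2 * mxnorm (B k) ^+ 2)) //.
  rewrite [leRHS]big_mkcond; apply: ler_sum => k _.
  rewrite !mxnorm_col; case: ifPn => kn; last first.
    rewrite big1 // => j _; by rewrite /B (negbTE kn) scaler0 mxE /sqmod expr0n addr0.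
  rewrite mulr_sumr; apply: ler_sum => j _.
  rewrite mxE sqmodM -!normc_sqmod -rmorphXn -(rmorph1 (real_complex R)) -rmorphB
    normc_real.
  by rewrite real_normK ?num_real // -sqrrN opprB.
have l5 := lt_quarters (sqnorm_tri hL (L2_trigpoly _ _) (L2_trigpoly _ _)) l1 l2.
have l4 := FB _ nM; rewrite (sqnormBC hF (L2_trigpoly B M)) in l4.
have l6 := lt_quarters (sqnorm_tri (L2_trigpoly _ _) (L2_trigpoly _ _) hF) l3 l4.
exact: lt_quarters (sqnorm_tri hL (L2_trigpoly _ _) hF) l5 l6.
Unshelve. all: by end_near.
Qed.

Lemma H2P F : H2 F <-> analytic F.
Proof. by split; [exact: H2_analytic | exact: analytic_H2]. Qed.

End HardySpace.

(** * Completeness *)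

Section RieszFischer.
Context {R : realType}.
Local Notation D := (@angles R).

(* The sequences [g j - 2 c / 2 ^ j] and [g j + 2 c / 2 ^ j] are respectively
   nondecreasing and nonincreasing, hence enclose a common limit. *)
Lemma fast_cauchy_limit (g : nat -> R) (c : R) :
  (forall j, `|g j.+1 - g j| <= c / 2 ^+ j) ->
  exists l, forall j, `|l - g j| <= 2 * c / 2 ^+ j.
Proof.
move=> hg; pose w j := 2 * c / 2 ^+ j.
have c0 : 0 <= c.
  by have := le_trans (normr_ge0 _) (hg 0%N); rewrite expr0 divr1.
have w0 j : 0 <= w j by rewrite divr_ge0 ?exprn_ge0 // mulr_ge0.
have wS j : w j.+1 = c / 2 ^+ j.
  by rewrite /w exprS invfM mulrACA mulfV ?mul1r.
have wE j : w j = 2 * (c / 2 ^+ j) by rewrite /w mulrA.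
have step j : g j - w j <= g j.+1 - w j.+1 /\ g j.+1 + w j.+1 <= g j + w j.
  have := hg j; rewrite ler_norml wS wE => /andP[]; set x := c / _; lra.
have u_nd i j : (i <= j)%N -> g i - w i <= g j - w j.
  by move=> /subnKC <-; elim: (j - i)%N => [|k ih]; rewrite ?addn0 // addnS; apply:
    le_trans ih (step _).1.
have v_ni i j : (i <= j)%N -> g j + w j <= g i + w i.
  by move=> /subnKC <-; elim: (j - i)%N => [|k ih]; rewrite ?addn0 // addnS; apply:
    le_trans (step _).2 ih.
have uv i j : g i - w i <= g j + w j.
  have [ij|/ltnW ji] := leqP i j.
    by apply: le_trans (u_nd _ _ ij) _; have := w0 j; lra.
  by apply: le_trans _ (v_ni _ _ ji); have := w0 i; lra.
pose E := range (fun j => g j - w j).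
have Eu : has_ubound E by exists (g 0%N + w 0%N) => _ [j _ <-].
exists (sup E) => j; rewrite ler_norml.
have h1 : g j - w j <= sup E by apply: ub_le_sup => //; exists j.
have h2 : sup E <= g j + w j.
  by apply: ge_sup; [exists (g 0%N - w 0%N); exists 0%N|move=> _ [i _ <-]].
by apply/andP; move: h1 h2; rewrite -/(w j); lra.
Qed.

Lemma fast_cauchy_measurable (E : set R) (g : nat -> R -> R) (c : R -> R) :
  @measurable _ (measurableTypeR R) E ->
  (forall j, measurable_fun D (g j)) ->
  (forall t, E t -> forall j, `|g j.+1 t - g j t| <= c t / 2 ^+ j) ->
  exists2 G : R -> R, measurable_fun D G &
    forall t, E t -> forall j, `|G t - g j t| <= 2 * c t / 2 ^+ j.
Proof.
move=> mE mg hg.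
have /choice [L hL] : forall t, exists l : R, E t ->
  forall j, `|l - g j t| <= 2 * c t / 2 ^+ j.
  move=> t; have [Et|nEt] := pselect (E t); last by exists 0.
  by have [l hl] := fast_cauchy_limit (hg t Et); exists l.
(* Nothing is known outside [E]. Multiplying by its indicator makes the sequence converge on all of
   the interval, which gives a measurable limit. *)
exists (fun t => \1_E t * L t); last first.
  by move=> t Et j; rewrite indicE mem_set // mul1r; exact: hL.
apply: (@measurable_fun_cvg _ (measurableTypeR R) _ D (fun j t => \1_E t * g j t)).
  move=> j; apply: measurable_funM; last exact: mg.
  exact: measurable_indic.
move=> t _; rewrite indicE; have [Et|nEt] := boolP (t \in E); last first.
  by rewrite mul0r; under eq_fun do rewrite mul0r; exact: cvg_cst.
rewrite mul1r; under eq_fun do rewrite mul1r.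
move: Et => /set_mem Et.
apply/cvgrPdist_lt => e e0.
have hw : (fun j => (2 * c t) * (2^-1 : R) ^+ j) @ \oo --> (0 : R).
  rewrite -(mulr0 (2 * c t)); apply: cvgM; first exact: cvg_cst.
  by apply: cvg_expr; rewrite ger0_norm ?invr_ge0 // invf_lt1 // ltr1n.
move/cvgr0Pnorm_lt : hw => /(_ _ e0) [N _ hN]; exists N => // j /= /hN.
apply: le_lt_trans; apply: le_trans (ler_norm _).
by have := hL t Et j; rewrite exprVn.
Qed.

End RieszFischer.

(** * The Riesz-Fischer theorem for vector-valued functions *)

Section Completeness.
Context {R : realType} {m : nat}.
Local Notation mu := (@lebesgue_measure R).
Local Notation D := (@angles R).
Local Notation Re := (@complex.Re R).
Local Notation Im := (@complex.Im R).
Implicit Types (F G K : R -> 'cV[R[i]]_m).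

Lemma integral_mean (f : R -> R) : integrable_circle f ->
  (\int[mu]_(t in D) (f t)%:E)%E = (2 * pi * mean f)%:E.
Proof.
move=> hf; rewrite /mean mulrA divff ?mul1r; last first.
  by rewrite gt_eqF // mulr_gt0 ?pi_gt0.
by rewrite /Rintegral fineK //; exact: (integrable_fin_num measurable_angles hf).
Qed.

Lemma L2_integral_le F (c : R) : measurable_circle F ->
  (\int[mu]_(t in D) (mxnorm (F t) ^+ 2)%:E <= (2 * pi * c)%:E)%E ->
  L2 F /\ sqnorm F <= c.
Proof.
move=> mF h; have hF : L2 F.
  split => //; rewrite /L2sqnorm; apply: lte_mul_pinfty => //.
    by rewrite lee_fin invpi_ge0.
  exact: le_lt_trans h (ltry _).
split => //; move: h; rewrite (integral_mean (L2_integrable_circle hF)) lee_fin.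
by rewrite ler_pM2l // mulr_gt0 ?pi_gt0.
Qed.

(** The weights 4^k are half-way, in exponent, between 1 and the rate 16^k. The weighted sum h of
    the |P_{k+1} - P_k|^2 is thus integrable, with terms of mean at most 4^{-k}. Where h = c^2 is
    finite the increments are at most c / 2^k, so each entry converges; and |F - P_j|^2 is at most a
    constant times h / 4^j, which is then integrated. *)
Lemma riesz_fischer (P : nat -> R -> 'cV[R[i]]_m) : (forall j, L2 (P j)) ->
  (forall j, sqnorm (P j.+1 - P j) <= (16^-1) ^+ j) ->
  exists F, L2 F /\ exists C : R, forall j, sqnorm (F - P j) <= C / 4 ^+ j.
Proof.
move=> hP hd; pose a k t : R := 4 ^+ k * mxnorm ((P k.+1 - P k) t) ^+ 2.
have a0 k t : 0 <= a k t by rewrite /a mulr_ge0 ?sqr_ge0 ?exprn_ge0.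
have ia k : integrable_circle (a k) by apply: integrable_circleZ; exact:
  (L2_integrable_circle (L2B (hP k.+1) (hP k))).
have ma k : @measurable_fun _ _ (measurableTypeR R) _ D (fun t => (a k t)%:E).
  by apply/measurable_EFinP; exact: (integrable_circle_measurable (ia k)).
pose h (t : R) : \bar R := (\sum_(0 <= k <oo) (a k t)%:E)%E.
have h0 t : (0 <= h t)%E by apply: nneseries_ge0 => k _ _; rewrite lee_fin.
have mh : @measurable_fun _ _ (measurableTypeR R) _ D h.
  by apply: ge0_emeasurable_sum => // k t _ _; rewrite lee_fin.
have avga k : mean (a k) <= 4^-1 ^+ k.
  rewrite meanZ; last exact: (L2_integrable_circle (L2B (hP k.+1) (hP k))).
  apply: (@le_trans _ _ (4 ^+ k * 16^-1 ^+ k)).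
    by rewrite ler_wpM2l ?exprn_ge0 //; exact: hd.
  by rewrite -exprMn; have -> : 4 * 16^-1 = 4^-1 :> R by field.
(* The sum of the 4^{-k} is 4/3, rounded up to 2. *)
have ih : (\int[mu]_(t in D) h t <= (2 * pi * 2)%:E)%E.
  rewrite (@integral_nneseries _ (measurableTypeR R)) //; last 2 first.
  - exact: measurable_angles.
  - by move=> k t _; rewrite lee_fin.
  apply: lime_le.
    apply: is_cvg_nneseries => k _ _; apply: integral_ge0 => t _; by rewrite lee_fin.
  apply: nearW => n.
  under eq_bigr do rewrite (integral_mean (ia _)).
  rewrite sumEFin lee_fin -mulr_sumr ler_wpM2l ?mulr_ge0 ?pi_ge0 //.
  apply: (@le_trans _ _ (\sum_(0 <= k < n) 4^-1 ^+ k)); first exact: ler_sum.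
  have q0 : 0 <= 4^-1 :> R by rewrite invr_ge0.
  have q1 : 4^-1 < 1 :> R by rewrite invf_lt1 // ltr1n.
  apply: le_trans (geom_tail 0 n q0 q1) _; rewrite expr0 div1r.
  have -> : (1 - 4^-1 : R)^-1 = 4 / 3 by field.
  by rewrite ler_pdivrMr //; lra.
pose E := D `&` [set t | (h t < +oo)%E].
have mE : @measurable _ (measurableTypeR R) E.
  by apply: (@emeasurable_fun_infty_o _ (measurableTypeR R)) => //; exact:
    measurable_angles.
pose c t := Num.sqrt (fine (h t)).
have hc t : E t -> h t = (c t ^+ 2)%:E.
  move=> [Dt ht]; rewrite /c sqr_sqrtr; last by rewrite fine_ge0.
  by rewrite fineK // ge0_fin_numE.
have c0 t : 0 <= c t by exact: sqrtr_ge0.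
have hdiff t : E t -> forall j, mxnorm ((P j.+1 - P j) t) <= c t / 2 ^+ j.
  move=> Et j; have ht : a j t <= c t ^+ 2.
    rewrite -lee_fin -(hc _ Et); apply: (@le_trans _ _ (\sum_(0 <= k < j.+1) (a k
      t)%:E)%E).
      rewrite big_nat_recr //= leeDr //; apply: sume_ge0 => k _; by rewrite lee_fin.
    by apply: nneseries_lim_ge => k _ _; rewrite lee_fin.
  rewrite ler_pdivlMr ?exprn_gt0 // -ler_sqr ?nnegrE //; last first.
    by rewrite mulr_ge0 ?mxnorm_ge0 ?exprn_ge0.
  apply: le_trans ht; rewrite /a exprMn mulrC exprAC.
  by have -> : (2 ^+ 2 : R) = 4 by ring.
have /choice [X hX] : forall k : 'I_m, exists G : R -> R, measurable_fun D G /\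
    forall t, E t -> forall j, `|G t - Re (P j t k 0)| <= 2 * c t / 2 ^+ j.
  move=> k; have [||G mG hG] := @fast_cauchy_measurable _ E (fun j t =>
    Re (P j t k 0)) c mE.
  - by move=> j; have [] := L2_cmeasurable k (hP j).
  - move=> t Et j; apply: le_trans (hdiff t Et j).
    apply: le_trans _ (normc_le_mxnorm _ k 0); apply: le_trans _ (normr_Re_le _).
    by rewrite fctE !mxE cReD; case: (P j t k 0).
  by exists G.
have /choice [Y hY] : forall k : 'I_m, exists G : R -> R, measurable_fun D G /\
    forall t, E t -> forall j, `|G t - Im (P j t k 0)| <= 2 * c t / 2 ^+ j.
  move=> k; have [||G mG hG] := @fast_cauchy_measurable _ E (fun j t =>
    Im (P j t k 0)) c mE.
  - by move=> j; have [] := L2_cmeasurable k (hP j).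
  - move=> t Et j; apply: le_trans (hdiff t Et j).
    apply: le_trans _ (normc_le_mxnorm _ k 0); apply: le_trans _ (normr_Im_le _).
    by rewrite fctE !mxE cImD; case: (P j t k 0).
  by exists G.
pose F : R -> 'cV[R[i]]_m := fun t => \col_k (X k t +i* Y k t).
have cF k : cmeasurable (fun t => F t k 0).
  split.
  - by rewrite (_ : _ \o _ = X k); [case: (hX k)|apply/funext => t; rewrite /F /= mxE].
  - by rewrite (_ : _ \o _ = Y k); [case: (hY k)|apply/funext => t; rewrite /F /= mxE].
(* Each of the m entries contributes two squares of 2 c / 2^j, that is 8 c^2 / 4^j; adding 1 keeps
   [C] positive for m = 0. The factor 2 in the next bound is the one of [ih]. *)
pose C : R := (8 * m%:R + 1).
have C0 : 0 < C by rewrite ltr_wpDl // mulr_ge0.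
have key j : L2 (F - P j) /\ sqnorm (F - P j) <= (C * 2) / 4 ^+ j.
  have Cj : 0 < C / 4 ^+ j by rewrite divr_gt0 ?exprn_gt0.
  have mFP : measurable_circle (F - P j).
    move=> k l; rewrite (ord1 l).
    have [h1 h2] := cmeasurableD (cF k) (cmeasurableM (cmeasurable_cst (-1))
      (L2_cmeasurable k (hP j))).
    split.
    - rewrite (_ : (fun t => _) = Re \o (fun t => F t k 0 + -1 * P j t k 0));
      first exact: h1.
      by apply/funext => t; rewrite /= fctE !mxE mulN1r.
    - rewrite (_ : (fun t => _) = Im \o (fun t => F t k 0 + -1 * P j t k 0));
      first exact: h2.
      by apply/funext => t; rewrite /= fctE !mxE mulN1r.
  apply: L2_integral_le => //.
  apply: (@le_trans _ _ (\int[mu]_(t in D) ((C / 4 ^+ j)%:E * h t))%E).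
    apply: ge0_le_integral.
    - exact: measurable_angles.
    - by move=> t _; rewrite lee_fin sqr_ge0.
    - by apply/measurable_EFinP; exact: measurable_mxnorm_sq.
    - by apply: measurable_funeM.
    (* Outside [E] the majorant is infinite, [C / 4 ^+ j] being positive, so the bound holds there
       whatever the value of [F]. *)
    move=> t Dt; have [ht|] := boolP (h t < +oo)%E; last first.
      by rewrite -leNgt leye_eq => /eqP ->; rewrite gt0_muley ?leey.
    have Et : E t by split.
    rewrite (hc t Et) -EFinM lee_fin mxnorm_col.
    apply: (@le_trans _ _ (\sum_(k < m) 8 * (c t ^+ 2 / 4 ^+ j))).
      apply: ler_sum => k _.
      have hx := (hX k).2 t Et j; have hy := (hY k).2 t Et j.
      set x := Re (P j t k 0) in hx; set y := Im (P j t k 0) in hy.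
      have -> : sqmod ((F - P j) t k 0) = `|X k t - x| ^+ 2 + `|Y k t - y| ^+ 2.
        rewrite !real_normK ?num_real // /sqmod fctE !mxE cReD cImD /x /y.
        by case: (P j t k 0).
      have s4 : (2 * c t / 2 ^+ j) ^+ 2 = 4 * (c t ^+ 2 / 4 ^+ j).
        have -> : (4 : R) ^+ j = (2 ^+ j) ^+ 2 by rewrite exprAC; congr (_ ^+ _); ring.
        by rewrite !exprMn exprVn; ring.
      have e0 : 0 <= 2 * c t / 2 ^+ j by rewrite divr_ge0 ?exprn_ge0 // mulr_ge0.
      have -> : 8 * (c t ^+ 2 / 4 ^+ j) = (2 * c t / 2 ^+ j) ^+ 2 + (2 * c t / 2 ^+
        j) ^+ 2.
        by rewrite s4; ring.
      by apply: lerD; rewrite lerXn2r ?nnegrE.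
    rewrite sumr_const card_ord -(mulr_natr (8 * _)).
    have -> : 8 * (c t ^+ 2 / 4 ^+ j) * m%:R = 8 * m%:R * (c t ^+ 2 / 4 ^+ j) by ring.
    have -> : C / 4 ^+ j * c t ^+ 2 = C * (c t ^+ 2 / 4 ^+ j) by ring.
    rewrite ler_wpM2r ?divr_ge0 ?sqr_ge0 ?exprn_ge0 //.
    by rewrite /C lerDl.
  rewrite (@ge0_integralZl_EFin _ (measurableTypeR R)) //; last 2 first.
  - exact: measurable_angles.
  - exact: ltW.
  apply: (@le_trans _ _ ((C / 4 ^+ j)%:E * (2 * pi * 2)%:E)%E).
    by apply: lee_wpmul2l => //; rewrite lee_fin ltW.
  by rewrite -EFinM lee_fin le_eqVlt; apply/orP; left; apply/eqP; ring.
exists F; split; last by exists (C * 2) => j; case: (key j).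
by have [h1 _] := key 0%N; have := L2D h1 (hP 0%N); rewrite subrK.
Qed.

End Completeness.

(** * The projection onto the Hardy space and analytic multipliers *)

Section HardyProjection.
Context {R : realType} {m : nat}.
Local Notation mu := (@lebesgue_measure R).
Local Notation D := (@angles R).
Implicit Types (F G K : R -> 'cV[R[i]]_m) (A : nat -> 'cV[R[i]]_m).

Lemma sqnorm_trigpolyB A n k : (k <= n)%N ->
  sqnorm (trigpoly A n - trigpoly A k) = \sum_(i < n) mxnorm (A i) ^+ 2 - \sum_(i <
    k) mxnorm (A i) ^+ 2.
Proof.
move=> kn; rewrite (sqnormB (L2_trigpoly _ _) (L2_trigpoly _ _)) !sqnorm_trigpoly
  (inner_trigpoly _ _ (L2_trigpoly _ _)).
have -> : \sum_(i < k) dotc (fourier (trigpoly A n) i) (A i) = (\sum_(i < k) mxnorm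
  (A i) ^+ 2)%:C.
  rewrite rmorph_sum; apply: eq_bigr => i _.
  by rewrite fourier_trigpoly (leq_trans (ltn_ord i) kn) dotcc.
by rewrite /=; ring.
Qed.

Lemma le_quarter_pow (x C : R) (k : nat) : (forall j, (k <= j)%N ->
  x <= C / 4 ^+ j) -> x <= 0.
Proof.
move=> h; have q : `|4^-1 : R| < 1 by rewrite ger0_norm ?invr_ge0 // invf_lt1 // ltr1n.
have := cvg_expr q; move=> /cvgr0Pnorm_lt hq.
apply: (@le_epsilon0 _ _ `|C|) => // e e0.
have [N _ hN] := hq _ e0.
have := hN (maxn k N) (leq_maxr _ _); rewrite /= ger0_norm ?exprn_ge0 ?invr_ge0 //
  => h1.
apply: le_trans (h (maxn k N) (leq_maxl _ _)) _.
apply: (@le_trans _ _ (`|C| / 4 ^+ maxn k N)).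
  by rewrite ler_wpM2r ?invr_ge0 ?exprn_ge0 // ler_norm.
by rewrite ler_wpM2l // -exprVn ltW.
Qed.

(** The projection keeps the frequencies k >= 0. By Bessel the partial sums are Cauchy, and a
    subsequence is extracted that converges at the rate [riesz_fischer] asks for. *)
Lemma exists_hardy_proj G : L2 G ->
  exists F, analytic F /\ forall K, analytic K -> inner (G - F) K = 0.
Proof.
move=> hG; pose s n := \sum_(i < n) mxnorm (fourier G i) ^+ 2.
have s_nd n k : (n <= k)%N -> s n <= s k.
  move=> nk; rewrite -subr_ge0 -sqnorm_trigpolyB //; exact: sqnorm_ge0.
have bd : has_ubound (range s).
  by exists (sqnorm G) => _ [n _ <-]; exact: bessel.
have hs : has_sup (range s) by split => //; exists (s 0%N); exists 0%N.
(* [N] comes from the supremum of the bounded nondecreasing sums [s]; the clause [j <= N] makes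
   every frequency appear eventually. *)
have /choice [N hN] : forall j : nat, exists N : nat, (j <= N)%N /\
    forall n, s n - s N <= (16^-1) ^+ j.
  move=> j; have e0 : 0 < (16^-1 : R) ^+ j by rewrite exprn_gt0 // invr_gt0.
  have [_ [k _ <-] hk] := sup_adherent e0 hs.
  exists (maxn j k); split; first exact: leq_maxl.
  move=> n; have h1 : s n <= sup (range s) by apply: ub_le_sup => //; exists n.
  have h2 := s_nd _ _ (leq_maxr j k).
  by move: hk h1 h2; set x := _ ^+ j; set u := sup _; lra.
(* Running maxima make the truncation lengths nondecreasing, as [sqnorm_trigpolyB] requires. *)
pose M j := \max_(i < j.+1) N i.
have MN j : (N j <= M j)%N by exact: (leq_bigmax (ord_max : 'I_j.+1)).
have MS j : (M j <= M j.+1)%N.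
  by apply/bigmax_leqP => i _; exact: (leq_bigmax (widen_ord (leqnSn j.+1) i)).
pose P j := trigpoly (fourier G) (M j).
have hP j : L2 (P j) by exact: L2_trigpoly.
have hd j : sqnorm (P j.+1 - P j) <= (16^-1) ^+ j.
  rewrite sqnorm_trigpolyB //; apply: le_trans ((hN j).2 (M j.+1)).
  by rewrite lerD2l lerN2; exact: s_nd.
have [F [hF [C hC]]] := riesz_fischer hP hd.
have lim e : 0 < e -> exists j, sqnorm (F - P j) < e.
  move=> e0; apply: contrapT => /forallNP h.
  suff : e <= 0 by rewrite leNgt e0.
  by apply: (@le_quarter_pow _ C 0) => j _; apply: le_trans (hC j); rewrite leNgt;
    apply/negP; exact: h.
have aF : analytic F.
  by apply: analytic_lim => // e /lim [j hj]; exists (P j); split => //; exact: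
    analytic_trigpoly.
exists F; split => // K aK; apply: (analytic_ortho (L2B hG hF) aK) => k v.
apply: sqmod_le0.
(* For j > k the functions [G] and [P j] have the same k-th coefficient, so [P j] may replace [G],
   and it is close to [F]. *)
apply: (@le_quarter_pow _ (C * sqnorm (monomial k v)) k.+1) => j kj.
have -> : inner (G - F) (monomial k v) = inner (P j - F) (monomial k v).
  rewrite !(innerBl _ hF (L2_monomial k v)) //
    (inner_fourier _ _ hG) (inner_fourier _ _ (hP j)) fourier_trigpoly.
  by rewrite (leq_trans kj) // (leq_trans (hN j).1).
apply: le_trans (cauchy_schwarz (L2B (hP j) hF) (L2_monomial k v)) _.
rewrite [leRHS]mulrAC ler_wpM2r ?sqnorm_ge0 // (sqnormBC (hP j) hF); exact: hC.
Qed.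

(** Existence guarantees that [xget] selects a genuine projection and not its default value. *)
Lemma hardy_projP G : L2 G ->
  analytic (hardy_proj G) /\ forall K, analytic K -> inner (G - hardy_proj G) K = 0.
Proof.
move=> hG; have [F [aF hF]] := exists_hardy_proj hG.
rewrite /hardy_proj; case: xgetP => [F' _ [hF' h]|/(_ F) []].
  by split; [exact/H2P | move=> K /H2P; exact: h].
by split; [exact/H2P | move=> K /H2P; exact: hF].
Qed.

Lemma analytic_proj G : L2 G -> analytic (hardy_proj G).
Proof. by move=> /hardy_projP []. Qed.

Lemma hardy_proj_unique G F : L2 G -> analytic F ->
  (forall K, analytic K -> inner (G - F) K = 0) -> ae_circle (fun t =>
    hardy_proj G t = F t).
Proof.
move=> hG aF h; have [aP hP] := hardy_projP hG.
set Q := hardy_proj G in aP hP *.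
have hF := analytic_L2 aF; have hQ := analytic_L2 aP; have aQF := analyticB aP aF.
have : sqnorm (Q - F) = 0.
  rewrite (sqnormE (L2B hQ hF)).
  (* Q - F lies in H^2 and is a difference of two functions orthogonal to H^2, hence is orthogonal
     to itself. *)
  have {1}-> : Q - F = (G - F) - (G - Q) by rewrite opprB [RHS]addrC addrA subrK.
  by rewrite (innerBl (L2B hG hF) (L2B hG hQ) (L2B hQ hF)) h // hP // subrr.
move=> /(sqnorm0_ae (L2B hQ hF)); apply: ae_circleS => t _; rewrite fctE => /eqP.
by rewrite subr_eq0 => /eqP.
Qed.

Lemma hardy_proj_analytic F : analytic F -> ae_circle (fun t => hardy_proj F t = F t).
Proof.
move=> aF; apply: hardy_proj_unique => //; first exact: analytic_L2.
by move=> K aK; rewrite subrr inner0l //; exact: analytic_L2.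
Qed.

Lemma mxnormB_sq p q (M N : 'M[R[i]]_(p, q)) :
  mxnorm (M - N) ^+ 2 <= 2 * mxnorm M ^+ 2 + 2 * mxnorm N ^+ 2.
Proof.
rewrite !mxnorm_sq !mulr_sumr -big_split; apply: ler_sum => i _ /=.
rewrite !mulr_sumr -big_split; apply: ler_sum => j _ /=.
rewrite !mxE; apply: le_trans (sqmodD _ _) _.
by rewrite lerD2l ler_wpM2l // /sqmod; case: (N i j) => x y /=; rewrite !sqrrN.
Qed.

Lemma scale_mulmxX (x y : R[i]) k (M : 'M[R[i]]_m) (v : 'cV[R[i]]_m) :
  ((x * y) ^+ k *: M) *m v = (x ^+ k *: M) *m (y ^+ k *: v).
Proof. by rewrite -!scalemxAl -scalemxAr scalerA exprMn. Qed.

Lemma analytic_Hinfty (Phi : R -> 'M[R[i]]_m) F : Hinfty Phi -> analytic F ->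
  analytic (fun t => Phi t *m F t).
Proof.
move=> [hPhi [g [[A hA] [B hB] hlim]]] aF; have hF := analytic_L2 aF.
have [mPhi [B' hB']] := hPhi.
(* Dominated convergence concerns sequences, so the radial limit is sampled along radii tending to
   1. *)
pose r n : R := 1 - n.+2%:R^-1.
have r0 n : 0 <= r n by rewrite subr_ge0 invf_le1 // ler1n.
have r1 n : r n < 1 by rewrite ltrBlDr ltrDl invr_gt0.
have rl : r @ \oo --> (1 : R).
  rewrite -[X in _ --> X]subr0; apply: cvgB; first exact: cvg_cst.
  by have := @cvg_harmonic R; rewrite -(cvg_shiftn 1); under eq_fun do rewrite /= addn1.
pose gn n t := g ((r n)%:C * expi t).
have nr n t : normc ((r n)%:C * expi t) = r n.
  by rewrite normcM normc_expi mulr1 normc_real ger0_norm.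
have gB n t : mxnorm (gn n t) <= B by apply: hB; rewrite nr.
have mgn n : measurable_circle (gn n).
  by move=> i j; exact: (power_series_cmeasurable hA (r0 n) (r1 n)).
have Lgn n : Linfty (gn n) by apply: (Linfty_bounded (c := B)) => // t _.
pose Gn n : R -> 'cV[R[i]]_m := fun t => gn n t *m F t.
have hGn n : L2 (Gn n) by exact: Linfty_L2.
have aGn n : analytic (Gn n).
  apply: analytic_lim => // e e0.
  have e1 : 0 < e / (sqnorm F + 1) by rewrite divr_gt0 // ltr_wpDl // sqnorm_ge0.
  have s0 : 0 < Num.sqrt (e / (sqnorm F + 1)) by rewrite sqrtr_gt0.
  have [N hN] := power_series_uniform hA (r0 n) (r1 n) s0.
  (* This is a partial sum of the series of g applied to F. Each term is a constant matrix acting on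
     e^{ikt} F, hence analytic. *)
  exists (\sum_(k < N) (fun t => ((r n)%:C ^+ k *: A k) *m (expi t ^+ k *: F t)));
    split.
    by apply: analytic_sum => k; apply: analytic_mx; exact: analytic_mul_expiX.
  have -> : Gn n - \sum_(k < N) (fun t => ((r n)%:C ^+ k *: A k) *m (expi t ^+ k *:
    F t)) =
      fun t => (gn n t - psum A ((r n)%:C * expi t) N) *m F t.
    apply/funext => t; rewrite !fctE fct_sumE mulmxBl /psum mulmx_suml; congr (_ - _).
    apply: eq_bigr => k _.
    exact: esym (scale_mulmxX _ _ _ _ _).
  apply: (@le_lt_trans _ _ (e / (sqnorm F + 1) * sqnorm F)).
    apply: sqnorm_bounded_mx => //.
      apply: (Linfty_bounded (c := Num.sqrt (e / (sqnorm F + 1)))).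
        move=> i j; have := cmeasurableD (mgn n i j) (cmeasurableM (cmeasurable_cst
          (-1))
          (cmeasurable_sum (index_enum 'I_N) (fun k =>
            cmeasurableM (cmeasurable_cst ((r n)%:C ^+ k * A k i j))
            (cmeasurable_expiX k)))).
        congr (cmeasurable _); apply/funext => t; rewrite !mxE mulN1r summxE.
        congr (_ - _); apply: eq_bigr => k _; rewrite mxE exprMn; ring.
      by move=> t _; apply: hN => //; rewrite nr.
    move=> t _; rewrite -[leRHS](sqr_sqrtr (ltW e1)) lerXn2r ?nnegrE ?mxnorm_ge0
      ?sqrtr_ge0 //.
    by apply: hN => //; rewrite nr.
  by rewrite mulrAC ltr_pdivrMr ?ltr_wpDl ?sqnorm_ge0 // ltr_pM2l // ltrDl.
have hPF : L2 (fun t => Phi t *m F t) by exact: Linfty_L2.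
pose a n t : R := mxnorm ((Phi t - gn n t) *m F t) ^+ 2.
have aE n : a n = (fun t => mxnorm (((fun t => Phi t *m F t) - Gn n) t) ^+ 2).
  by apply/funext => t; rewrite /a mulmxBl.
have ia n : integrable_circle (a n) by rewrite aE; exact:
  (L2_integrable_circle (L2B hPF (hGn n))).
(* Dominating constant: [B'] bounds Phi almost everywhere on the circle, [B] bounds its extension on
   the disc. *)
pose C := 2 * B' ^+ 2 + 2 * B ^+ 2.
have [] := @dominated_convergence _ (measurableTypeR R) R mu D measurable_angles
  (fun n t => (a n t)%:E) (fun=> 0%E) (fun t => (C * mxnorm (F t) ^+ 2)%:E).
- by move=> n; apply/measurable_EFinP; exact: (integrable_circle_measurable (ia n)).
- exact: measurable_cst.
- apply: (ae_circleS _ hlim) => t _ hl.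
  have hl2 : (fun n => mxnorm (gn n t - Phi t)) @ \oo --> (0 : R).
    by move/cvg_at_leftP : hl => /(_ r); apply.
  apply/fine_cvgP; split; first by apply: nearW.
  apply: (@squeeze_cvgr _ _ _ _ (fun=> 0) (fun n =>
    mxnorm (gn n t - Phi t) ^+ 2 * mxnorm (F t) ^+ 2)).
  + apply: nearW => n /=; rewrite sqr_ge0 /= /a.
    apply: le_trans (mxnorm_mulmx _ _) _; rewrite -opprB.
    by rewrite ler_wpM2r ?sqr_ge0 // !mxnorm_sq; apply: ler_sum => i _; apply:
      ler_sum => j _;
      rewrite !mxE /sqmod; case: (_ - _) => x y /=; rewrite !sqrrN.
  + exact: cvg_cst.
  + have -> : (0 : R) = 0 * 0 * mxnorm (F t) ^+ 2 by rewrite !mul0r.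
    by apply: cvgM; [apply: cvgM|exact: cvg_cst].
- exact: (integrable_circleZ C (L2_integrable_circle hF)).
- apply: (@filterS _ (almost_everywhere mu) _ _ _ _ hB') => t hb n Dt.
  have {}hb : mxnorm (Phi t) <= B' := hb Dt.
  rewrite /= lee_fin ger0_norm ?sqr_ge0 // /a.
  apply: le_trans (mxnorm_mulmx _ _) _; rewrite ler_wpM2r ?sqr_ge0 //.
  apply: le_trans (mxnormB_sq _ _) _; rewrite /C; apply: lerD; rewrite ler_wpM2l //.
    by rewrite lerXn2r ?nnegrE ?mxnorm_ge0 //; apply: le_trans hb; exact: mxnorm_ge0.
  by rewrite lerXn2r ?nnegrE ?mxnorm_ge0 //; apply: le_trans (gB n t); exact:
    mxnorm_ge0.
move=> _ + _ => /fine_cvgP [_ /cvgr0Pnorm_lt hcv].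
apply: analytic_lim => // e e0.
have pi2 : 0 < 2 * pi :> R by rewrite mulr_gt0 ?pi_gt0.
have e1 : 0 < 2 * pi * e by rewrite mulr_gt0.
have [N _ hN] := hcv _ e1; exists (Gn N); split => //.
have := hN N (leqnn N); rewrite /=.
have -> : (\int[mu]_(x in D) `|(a N x)%:E - 0| = \int[mu]_(x in D) (a N x)%:E)%E.
  by apply: eq_integral => t _; rewrite sube0 gee0_abs // lee_fin sqr_ge0.
rewrite (integral_mean (ia N)) /= ger0_norm; last first.
  by apply: mulr_ge0; [exact: ltW|apply: mean_ge0 => t _; exact: sqr_ge0].
by rewrite ltr_pM2l // aE.
Qed.

End HardyProjection.

(** * Finite-dimensional subspaces *)

Section Orthonormal.
Context {R : realType} {m : nat}.
Implicit Types (F G K : R -> 'cV[R[i]]_m) (u v : nat -> R -> 'cV[R[i]]_m) (c :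
  nat -> R[i]).

(** Families are indexed by [nat] and cut off at [n], so that Gram-Schmidt can lengthen them without
    reindexing ordinals. *)
Definition combination c u n : R -> 'cV[R[i]]_m := \sum_(i < n) c i *: u i.

Definition orthonormal_seq u n : Prop :=
  (forall i, analytic (u i)) /\
  forall i j, (i < n)%N -> (j < n)%N -> inner (u i) (u j) = (i == j)%:R.

Lemma analytic_combination c u n : (forall i, analytic (u i)) ->
  analytic (combination c u n).
Proof. by move=> h; apply: analytic_sum => i; exact: analyticZ. Qed.

Lemma L2_combination c u n : (forall i, analytic (u i)) -> L2 (combination c u n).
Proof. by move=> h; apply/analytic_L2/analytic_combination. Qed.

Lemma inner_combinationl c u n K : (forall i, analytic (u i)) -> L2 K ->
  inner (combination c u n) K = \sum_(i < n) c i * inner (u i) K.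
Proof.
move=> hu hK; rewrite /combination (inner_suml _ (fun i : 'I_n =>
  L2Z (c i) (analytic_L2 (hu i))) hK).
by apply: eq_bigr => i _; rewrite (innerZl _ (analytic_L2 (hu i)) hK).
Qed.

Lemma inner_combination_orthonormal c u n j : orthonormal_seq u n -> (j < n)%N ->
  inner (combination c u n) (u j) = c j.
Proof.
move=> [hu ho] jn; rewrite (inner_combinationl _ _ hu (analytic_L2 (hu j))).
rewrite (bigD1 (Ordinal jn)) //= ho // eqxx mulr1 big1 ?addr0 // => i.
by rewrite -val_eqE /= => ij; rewrite ho // (negbTE ij) mulr0.
Qed.

Lemma sqnorm_combination c u n : orthonormal_seq u n ->
  sqnorm (combination c u n) = \sum_(i < n) sqmod (c i).
Proof.
move=> h; have hL := L2_combination c n h.1.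
apply: complexI; rewrite -(inner_sqnorm hL) {1}/combination.
rewrite (inner_suml _ (fun i : 'I_n => L2Z (c i) (analytic_L2 (h.1 i))) hL)
  rmorph_sum /=.
apply: eq_bigr => i _; rewrite (innerZl _ (analytic_L2 (h.1 i)) hL) (innerC hL
  (analytic_L2 (h.1 i))).
by rewrite (inner_combination_orthonormal c h) // mulcJE.
Qed.

Definition span_proj u n F : R -> 'cV[R[i]]_m := combination (fun i =>
  inner F (u i)) u n.

Lemma sqnormB_span_proj u n F : orthonormal_seq u n -> L2 F ->
  sqnorm (F - span_proj u n F) = sqnorm F - \sum_(i < n) sqmod (inner F (u i)).
Proof.
move=> h hF; have hL := L2_combination (fun i => inner F (u i)) n h.1.
rewrite (sqnormB hF hL) (sqnorm_combination _ h) -(Re_innerC hF hL).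
rewrite (inner_combinationl _ _ h.1 hF).
have -> : \sum_(i < n) inner F (u i) * inner (u i) F = (\sum_(i < n) sqmod (inner F
  (u i)))%:C.
  rewrite rmorph_sum; apply: eq_bigr => i _.
  by rewrite (innerC hF (analytic_L2 (h.1 i))) mulcJE.
by rewrite /=; ring.
Qed.

Lemma bessel_orthonormal u n F : orthonormal_seq u n -> L2 F ->
  \sum_(i < n) sqmod (inner F (u i)) <= sqnorm F.
Proof. by move=> h hF; rewrite -subr_ge0 -sqnormB_span_proj // sqnorm_ge0. Qed.

Lemma combinationD c1 c2 u n :
  combination (fun i => c1 i + c2 i) u n = combination c1 u n + combination c2 u n.
Proof. by rewrite /combination -big_split; apply: eq_bigr => i _; rewrite scalerDl. Qed.

Lemma combinationZ (a : R[i]) c u n :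
  combination (fun i => a * c i) u n = a *: combination c u n.
Proof. by rewrite /combination scaler_sumr; apply: eq_bigr => i _; rewrite scalerA. Qed.

Lemma eq_combination c1 c2 u1 u2 n : (forall i, (i < n)%N -> c1 i = c2 i) ->
  (forall i, (i < n)%N -> u1 i = u2 i) -> combination c1 u1 n = combination c2 u2 n.
Proof. by move=> hc hu; apply: eq_bigr => i _; rewrite hc // hu. Qed.

Lemma span_projD u n F G : (forall i, analytic (u i)) -> L2 F -> L2 G ->
  span_proj u n (F + G) = span_proj u n F + span_proj u n G.
Proof.
move=> hu hF hG; rewrite /span_proj -combinationD; apply: eq_combination => // i _.
by rewrite (innerDl hF hG (analytic_L2 (hu i))).
Qed.

Lemma span_projZ (a : R[i]) u n F : (forall i, analytic (u i)) -> L2 F ->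
  span_proj u n (a *: F) = a *: span_proj u n F.
Proof.
move=> hu hF; rewrite /span_proj -combinationZ; apply: eq_combination => // i _.
by rewrite (innerZl _ hF (analytic_L2 (hu i))).
Qed.

Lemma ae_sum (I : Type) (r : seq I) (F G : I -> R -> 'cV[R[i]]_m) :
  (forall i, ae_circle (fun t => F i t = G i t)) ->
  ae_circle (fun t => (\sum_(i <- r) F i) t = (\sum_(i <- r) G i) t).
Proof.
move=> h; elim/big_ind2: _ => [|x a y b h1 h2|i _]; last exact: h.
  exact: ae_circleT.
by apply: ae_circleS (ae_circleI h1 h2) => t _ [e1 e2]; rewrite !fctE e1 e2.
Qed.

Lemma analytic_ae F G : L2 F -> analytic G -> ae_circle (fun t => F t = G t) ->
  analytic F.
Proof.
move=> hF aG h; apply: analytic_lim => // e e0; exists G; split => //.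
rewrite (sqnorm_ae0 (L2B hF (analytic_L2 aG))) //.
by apply: ae_circleS h => t _ e1; rewrite fctE e1 subrr.
Qed.

(** A vector whose residue has norm zero adds nothing to the basis, whence k <= n. The two
    inclusions of spans differ in kind: each v_i equals its projection up to a null set, while each
    u_j is literally a combination of the v_i. *)
Lemma gram_schmidt v n : (forall i, analytic (v i)) -> exists k u,
  [/\ (k <= n)%N, orthonormal_seq u k,
      forall i, (i < n)%N -> sqnorm (v i - span_proj u k (v i)) = 0 &
      forall j, (j < k)%N -> exists c, u j = combination c v n].
Proof.
move=> hv; elim: n => [|n [k [u [kn hu hA hB]]]].
  by exists 0%N, v; split => //.
have hvn := analytic_L2 (hv n).
pose w := v n - span_proj u k (v n).
have aw : analytic w by apply: analyticB => //; exact: analytic_combination hu.1.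
have hw := analytic_L2 aw.
have hB' c : exists c', combination c v n = combination c' v n.+1.
  exists (fun i => if (i < n)%N then c i else 0).
  rewrite /combination big_ord_recr /= ltnn scale0r addr0.
  by apply: eq_bigr => i _; rewrite ltn_ord.
have [w0|w0] := eqVneq (sqnorm w) 0.
  exists k, u; split; [exact: leqW|exact: hu| |].
    by move=> i; rewrite ltnS leq_eqVlt => /orP[/eqP ->|]; [exact: w0|exact: hA].
  by move=> j /hB [c ->]; exact: hB'.
have wp : 0 < sqnorm w by rewrite lt_neqAle eq_sym w0 sqnorm_ge0.
pose s := ((Num.sqrt (sqnorm w))^-1)%:C : R[i].
pose u' j := if (j < k)%N then u j else s *: w.
have au' j : analytic (u' j) by rewrite /u'; case: ifP => _; [exact: hu.1|exact:
  analyticZ].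
have uE j : (j < k)%N -> u' j = u j by rewrite /u' => ->.
have uk : u' k = s *: w by rewrite /u' ltnn.
have wu j : (j < k)%N -> inner w (u j) = 0.
  move=> jk; rewrite /w (innerBl hvn (L2_combination _ _ hu.1) (analytic_L2 (hu.1 j))).
  by rewrite (inner_combination_orthonormal _ hu jk) subrr.
have ss : s * s = ((sqnorm w)^-1)%:C.
  by rewrite /s -rmorphM -invfM -expr2 (sqr_sqrtr (ltW wp)).
have hu' : orthonormal_seq u' k.+1.
  split; [exact: au'|] => i j.
  rewrite !ltnS [(i <= k)%N]leq_eqVlt [(j <= k)%N]leq_eqVlt.
  move=> /orP[/eqP ->|ik] /orP[/eqP ->|jk].
  - rewrite uk eqxx (innerZl _ hw (L2Z _ hw)) (innerZr _ hw hw) (inner_sqnorm hw).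
    rewrite (_ : Num.conj s = s); last by apply: complex_ext; rewrite /= ?oppr0.
    by rewrite mulrA ss -rmorphM mulVf.
  - by rewrite uk (uE j jk) (innerZl _ hw (analytic_L2 (hu.1 j))) (wu j jk) mulr0
    gtn_eqF.
  - rewrite uk (uE i ik) (innerZr _ (analytic_L2 (hu.1 i)) hw) (innerC hw
    (analytic_L2 (hu.1 i))).
    by rewrite (wu i ik) rmorph0 mulr0 ltn_eqF.
  - by rewrite (uE i ik) (uE j jk); exact: hu.2.
have projE F : L2 F -> span_proj u' k.+1 F = span_proj u k F + inner F (u' k) *: u' k.
  move=> hF; rewrite /span_proj /combination big_ord_recr /=; congr (_ + _).
  by apply: eq_bigr => i _; rewrite uE.
exists k.+1, u'; split; [by rewrite ltnS|exact: hu'| |].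
- move=> i; rewrite ltnS leq_eqVlt => /orP[/eqP ->|/hA hi].
    suff -> : v n - span_proj u' k.+1 (v n) = 0 by rewrite (sqnormE L2_0) (inner0l
      L2_0).
    rewrite (projE _ hvn) opprD addrA -/w uk (innerZr _ hvn hw).
    have -> : inner (v n) w = inner w w.
      rewrite {2}/w (innerBl hvn (L2_combination _ _ hu.1) hw).
      rewrite (inner_combinationl _ _ hu.1 hw) big1 ?subr0 // => j _.
      by rewrite (innerC hw (analytic_L2 (hu.1 j))) (wu j (ltn_ord j)) rmorph0 mulr0.
    rewrite (inner_sqnorm hw) (_ : Num.conj s = s); last by apply: complex_ext;
      rewrite /= ?oppr0.
    by rewrite scalerA mulrAC ss -rmorphM mulVf // scale1r subrr.
  have hvi := analytic_L2 (hv i).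
  have aei := sqnorm0_ae (L2B hvi (L2_combination _ _ hu.1)) hi.
  (* An earlier vector lies almost everywhere in the span of the old basis, which is orthogonal to
     [w], so its projection gains no new term. *)
  have z : inner (v i) (u' k) = 0.
    rewrite (inner_ae (G := span_proj u k (v i)) hvi (L2_combination _ _ hu.1)
      (analytic_L2 (au' k))).
      rewrite (inner_combinationl _ _ hu.1 (analytic_L2 (au' k))) big1 // => j _.
      rewrite uk (innerZr _ (analytic_L2 (hu.1 j)) hw) (innerC hw (analytic_L2
        (hu.1 j))).
      by rewrite (wu j (ltn_ord j)) rmorph0 !mulr0.
    by apply: ae_circleS aei => t _; rewrite fctE => /eqP; rewrite subr_eq0 => /eqP.
  by rewrite (projE _ hvi) z scale0r addr0.
- move=> j; rewrite ltnS leq_eqVlt => /orP[/eqP ->|jk]; last first.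
    by rewrite (uE j jk); have [c ->] := hB j jk; exact: hB'.
  rewrite uk.
  have [c hc] : exists c, span_proj u k (v n) = combination c v n.
    rewrite /span_proj; elim: {-2}k (leqnn k) => [|l ih] lk.
      exists (fun=> 0); rewrite /combination big_ord0 big1 // => i _; exact: scale0r.
    have [c hc] := ih (ltnW lk); have [d hd] := hB l lk.
    exists (fun i => c i + inner (v n) (u l) * d i).
    by rewrite combinationD combinationZ -hc -hd /combination big_ord_recr.
  exists (fun i => s * (if (i < n)%N then - c i else 1)).
  rewrite combinationZ; congr (_ *: _); rewrite /w hc /combination big_ord_recr /=
    ltnn scale1r.
  rewrite addrC; congr (_ + _); rewrite -sumrN; apply: eq_bigr => i _.
  by rewrite ltn_ord scaleNr.
Qed.

End Orthonormal.

(** * Closed spans of finitely many functions *)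

Section ClosedSpan.
Context {R : realType} {m : nat}.
Implicit Types (F G K : R -> 'cV[R[i]]_m).

(** Passes from families on ['I_n] to families on [nat]. With default 0 the padding stays analytic,
    as the lemmas on sequences demand for every index. *)
Definition extend_ord (T : Type) (x0 : T) n (v : 'I_n -> T) (i : nat) : T :=
  oapp v x0 (insub i).

Lemma extend_ordE (T : Type) (x0 : T) n (v : 'I_n -> T) (i : 'I_n) :
  extend_ord x0 v i = v i.
Proof. by rewrite /extend_ord valK. Qed.

(** Taking the closure adds only null modifications, since a finite-dimensional span is closed. The
    closed span becomes the set of almost-everywhere fixed points of an orthogonal projection, from
    which linearity and dimension are read off. *)
Lemma closed_span_basis n (v : 'I_n -> R -> 'cV[R[i]]_m) : (forall i, analytic (v i)) ->
  exists k u, [/\ (k <= n)%N, orthonormal_seq u k &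
    forall F, closed_span v F <->
      L2 F /\ ae_circle (fun t => F t = span_proj u k F t)].
Proof.
move=> av; pose w := extend_ord 0 v.
have aw i : analytic (w i).
  by rewrite /w /extend_ord; case: (insub i) => [j|] /=; [exact: av|exact: analytic0].
have wE c : combination c w n = \sum_(i < n) c i *: v i.
  by apply: eq_bigr => i _; rewrite /w extend_ordE.
have [k [u [kn hu hA hB]]] := gram_schmidt n aw.
have hL X : L2 (span_proj u k X) by exact: L2_combination hu.1.
pose Z X := analytic X /\ ae_circle (fun t => X t = span_proj u k X t).
have ZD X Y : Z X -> Z Y -> Z (X + Y).
  move=> [aX eX] [aY eY]; split; first exact: analyticD.
  apply: ae_circleS (ae_circleI eX eY) => t _ [e1 e2].
  by rewrite (span_projD _ hu.1 (analytic_L2 aX) (analytic_L2 aY)) !fctE -e1 -e2.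
have ZZ c X : Z X -> Z (c *: X).
  move=> [aX eX]; split; first exact: analyticZ.
  by apply: ae_circleS eX => t _ e; rewrite (span_projZ _ _ hu.1 (analytic_L2 aX))
    !fctE -e.
have Zv i : Z (v i).
  split; first exact: av.
  have := sqnorm0_ae (L2B (analytic_L2 (aw i)) (hL _)) (hA i (ltn_ord i)).
  rewrite /w extend_ordE; apply: ae_circleS => t _; rewrite fctE => /eqP.
  by rewrite subr_eq0 => /eqP.
have Z0 : Z 0.
  have := ZZ 0 0; rewrite scale0r => h; split; first exact: analytic0.
  by rewrite -(scale0r (0 : R -> 'cV[R[i]]_m)) (span_projZ _ _ hu.1 L2_0) !scale0r;
    exact: ae_circleT.
exists k, u; split; [exact: kn|exact: hu|] => F; split.
  move=> [hF happ]; split; first exact: hF.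
  suff z : sqnorm (F - span_proj u k F) = 0.
    apply: ae_circleS (sqnorm0_ae (L2B hF (hL F)) z) => t _; rewrite fctE => /eqP.
    by rewrite subr_eq0 => /eqP.
  apply/eqP; rewrite eq_le sqnorm_ge0 andbT.
  apply: (@le_epsilon0 _ _ 1) => // e e0; rewrite mul1r.
  have [G [c Gc] FG] := happ _ e0.
  have [aG eG] : Z G.
    by rewrite Gc; elim/big_ind: _ => [|? ?|i _]; [exact: Z0|exact: ZD|exact: ZZ].
  have hG := analytic_L2 aG; have hFG := L2B hF hG.
  rewrite (L2sqnormE hFG) lte_fin in FG.
  (* [G] is fixed by the projection almost everywhere, so F and F - G have the same residue, whose
     squared norm is at most that of F - G. *)
  rewrite (sqnorm_ae (G := (F - G) - span_proj u k (F - G)) (L2B hF (hL F)) (L2B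
    hFG (hL _))).
    rewrite (sqnormB_span_proj hu hFG); apply: le_trans (ltW FG).
    by rewrite gerBl; apply: sumr_ge0 => i _; exact: sqmod_ge0.
  apply: ae_circleS eG => t _ e1.
  have -> : span_proj u k (F - G) = span_proj u k F - span_proj u k G.
    rewrite -scaleN1r (span_projD _ hu.1 hF (L2Z _ hG)) (span_projZ _ _ hu.1 hG).
    by rewrite scaleN1r.
  by rewrite !fctE -e1 opprB addrA subrK.
move=> [hF eF]; split; first exact: hF.
move=> e e0; exists (span_proj u k F); last first.
  rewrite (L2sqnormE (L2B hF (hL F))) (sqnorm_ae0 (L2B hF (hL F))) //.
  by apply: ae_circleS eF => t _ e1; rewrite !fctE -e1 subrr.
have [c hc] : exists c, span_proj u k F = combination c w n.
  rewrite /span_proj; elim: {-2}k (leqnn k) => [|l ih] lk.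
    exists (fun=> 0); rewrite /combination big_ord0 big1 // => i _; exact: scale0r.
  have [c hc] := ih (ltnW lk); have [d hd] := hB l lk.
  exists (fun i => c i + inner F (u l) * d i).
  by rewrite combinationD combinationZ -hc -hd /combination big_ord_recr.
by exists c; rewrite hc wE.
Qed.

Lemma subspace_closed_span n (v : 'I_n -> R -> 'cV[R[i]]_m) :
  (forall i, analytic (v i)) ->
  subspace_of_H2 (closed_span v).
Proof.
move=> av; have [k [u [_ hu hE]]] := closed_span_basis av.
have hL X : analytic (span_proj u k X) by exact: analytic_combination hu.1.
split.
- by move=> F /hE [hF eF]; apply/H2P; exact: analytic_ae eF.
- apply/hE; split; first exact: L2_0.
  by rewrite -(scale0r (0 : R -> 'cV[R[i]]_m)) (span_projZ _ _ hu.1 L2_0) !scale0r;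
    exact: ae_circleT.
- move=> a F G /hE [hF eF] /hE [hG eG]; apply/hE; split; first exact: L2D (L2Z _ hF) hG.
  apply: ae_circleS (ae_circleI eF eG) => t _ [e1 e2].
  by rewrite (span_projD _ hu.1 (L2Z a hF) hG) (span_projZ _ _ hu.1 hF) !fctE -e1 -e2.
Qed.

Lemma has_dim_closed_span n (v : 'I_n -> R -> 'cV[R[i]]_m) :
  (forall i, analytic (v i)) ->
  exists2 k, (k <= n)%N & has_dim (closed_span v) k.
Proof.
move=> av; have [k [u [kn hu hE]]] := closed_span_basis av.
exists k; first exact: kn.
have hu2 i : L2 (u i) := analytic_L2 (hu.1 i).
exists (fun i => u i); split.
- move=> i; apply/hE; split; first exact: hu2.
  apply: ae_circleT => t _; rewrite /span_proj /combination (bigD1 i) //=.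
  rewrite hu.2 // eqxx scale1r big1 ?addr0 // => j ji.
  by rewrite hu.2 // eq_sym -val_eqE in ji *; rewrite (negbTE ji) scale0r.
- move=> c hc i; pose d := extend_ord 0 c.
  have dE : combination d u k = \sum_(i < k) c i *: u i.
    by apply: eq_bigr => j _; rewrite /d extend_ordE.
  have := inner_combination_orthonormal d hu (ltn_ord i).
  rewrite /d extend_ordE => <-.
  rewrite (inner_ae (G := 0) (L2_combination _ _ hu.1) L2_0 (hu2 i)) ?(inner0l (hu2
    i)) //.
  by rewrite dE.
- by move=> F /hE [_ eF]; exists (fun i : 'I_k => inner F (u i)).
Qed.

(** Corresponding combinations differ by null functions, which distances in L^2 do not see. This
    yields an inclusion of sets from generators that agree only almost everywhere. *)
Lemma closed_span_ae n (v w : 'I_n -> R -> 'cV[R[i]]_m) :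
  (forall i, analytic (v i)) -> (forall i, analytic (w i)) ->
  (forall i, ae_circle (fun t => v i t = w i t)) ->
  closed_span v `<=` closed_span w.
Proof.
move=> av aw h F [hF happ]; split; first exact: hF.
move=> e e0; have [G [c Gc] FG] := happ _ e0.
exists (\sum_(i < n) c i *: w i); first by exists c.
have aG : analytic G by rewrite Gc; apply: analytic_sum => i; exact: analyticZ.
have aG' : analytic (\sum_(i < n) c i *: w i) by apply: analytic_sum => i; exact:
  analyticZ.
rewrite (L2sqnormE (L2B hF (analytic_L2 aG))) in FG.
rewrite (L2sqnormE (L2B hF (analytic_L2 aG'))).
rewrite -(sqnorm_ae (L2B hF (analytic_L2 aG)) (L2B hF (analytic_L2 aG'))) //.
have := @ae_sum _ _ _ (index_enum 'I_n) (fun i => c i *: v i) (fun i => c i *: w i).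
rewrite -Gc => /(_ _)/wrap[].
  by move=> i; apply: ae_circleS (h i) => t _ e1; rewrite !fctE e1.
by apply: ae_circleS => t _ e1; rewrite !fctE e1.
Qed.

End ClosedSpan.

(** * The perturbed Toeplitz operator *)

Section Kernel.
Context {R : realType} {m : nat}.
Implicit Types (F G K : R -> 'cV[R[i]]_m) (Phi : R -> 'M[R[i]]_m).

(** The difference F - G is itself an admissible test function K. *)
Lemma analytic_eq F G : analytic F -> analytic G -> (forall K, analytic K ->
  inner F K = inner G K) ->
  ae_circle (fun t => F t = G t).
Proof.
move=> aF aG h; have hF := analytic_L2 aF; have hG := analytic_L2 aG;
  have aFG := analyticB aF aG.
have : sqnorm (F - G) = 0.
  rewrite (sqnormE (L2B hF hG)) (innerBl hF hG (L2B hF hG)) h //.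
  by rewrite subrr.
move=> /(sqnorm0_ae (L2B hF hG)); apply: ae_circleS => t _; rewrite fctE => /eqP.
by rewrite subr_eq0 => /eqP.
Qed.

Lemma backward_shiftE F : analytic F -> backward_shift F = div_expi (F - (fun=>
  fourier F 0)).
Proof. by move=> aF; rewrite /backward_shift (H2_at0 (analytic_H2 aF)). Qed.

Lemma analytic_backward_shift F : analytic F -> analytic (backward_shift F).
Proof. by move=> aF; rewrite (backward_shiftE aF); exact: analytic_backward. Qed.

Lemma inner_backward_shift F K : analytic F -> analytic K ->
  inner (backward_shift F) K = inner F (mul_expi K).
Proof.
move=> aF aK; rewrite (backward_shiftE aF) div_expiB.
have hc := L2_div_expi (L2_cst (fourier F 0)).
rewrite (innerBl (L2_div_expi (analytic_L2 aF)) hc (analytic_L2 aK)).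
by rewrite (inner_div_expi_cst _ aK) subr0 inner_div_expi.
Qed.

Lemma inner_adjoint Phi F K :
  inner (fun t => pointwise_adjoint Phi t *m F t) K = inner F (fun t => Phi t *m K t).
Proof.
rewrite /inner; apply: circle_mean_eq => t _.
under eq_bigr do rewrite mxE mulr_suml.
rewrite exchange_big /=; apply: eq_bigr => j _.
rewrite mxE rmorph_sum mulr_sumr; apply: eq_bigr => k _.
by rewrite !mxE rmorphM /=; ring.
Qed.

Lemma Linfty_adjoint Phi : Linfty Phi -> Linfty (pointwise_adjoint Phi).
Proof.
move=> [mP [B hB]]; split.
  move=> i j; have := cmeasurable_conj (mP j i); congr (cmeasurable _).
  by apply/funext => t; rewrite !mxE.
exists B; apply: ae_circleS hB => t _; congr (_ <= _).
apply/eqP; rewrite -(eqrXn2 (n := 2)) ?mxnorm_ge0 // !mxnorm_sq exchange_big.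
apply/eqP; apply: eq_bigr => i _; apply: eq_bigr => j _.
by rewrite !mxE /sqmod cReJ cImJ sqrrN.
Qed.

(** * Multiplication by an inner function and its Toeplitz adjoint *)

Section InnerMultiplier.
Local Notation Re := (@complex.Re R).
Variable Theta : R -> 'M[R[i]]_m.
Hypothesis hTheta : inner_multiplier Theta.

Definition theta_mul F : R -> 'cV[R[i]]_m := fun t => Theta t *m F t.

Lemma analytic_theta_mul F : analytic F -> analytic (theta_mul F).
Proof. by move=> aF; apply: analytic_Hinfty => //; case: hTheta. Qed.

Lemma L2_theta_mul F : L2 F -> L2 (theta_mul F).
Proof. by move=> hF; apply: Linfty_L2 => //; case: hTheta => [[]]. Qed.

Lemma sqnorm_theta_mul F : L2 F -> sqnorm (theta_mul F) = sqnorm F.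
Proof.
move=> hF; apply: mean_ae.
- by apply: measurable_mxnorm_sq; case: (L2_theta_mul hF).
- by apply: measurable_mxnorm_sq; case: hF.
- by case: hTheta => _; apply: ae_circleS => t _ h; rewrite /theta_mul h.
Qed.

Lemma theta_mulD F G : theta_mul (F + G) = theta_mul F + theta_mul G.
Proof. by apply/funext => t; rewrite /theta_mul !fctE mulmxDr. Qed.

Lemma theta_mulZ (a : R[i]) F : theta_mul (a *: F) = a *: theta_mul F.
Proof. by apply/funext => t; rewrite /theta_mul !fctE scalemxAr. Qed.

(** Polarization: expanding the norm of a sum gives the real parts. *)
Lemma inner_theta_mul F G : L2 F -> L2 G -> inner (theta_mul F) (theta_mul G) =
  inner F G.
Proof.
move=> hF hG.
have re X : L2 X -> Re (inner (theta_mul X) (theta_mul G)) = Re (inner X G).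
  move=> hX; have := sqnorm_theta_mul (L2D hX hG).
  rewrite theta_mulD (sqnormD (L2_theta_mul hX) (L2_theta_mul hG)) (sqnormD hX hG).
  rewrite (sqnorm_theta_mul hX) (sqnorm_theta_mul hG) => /addrI.
  by apply: mulfI; rewrite pnatr_eq0.
apply: complex_ext; first exact: re.
(* Replacing F by iF turns the real part into minus the imaginary part. *)
have := re _ (L2Z (0 +i* 1) hF); rewrite theta_mulZ.
rewrite (innerZl _ (L2_theta_mul hF) (L2_theta_mul hG)) (innerZl _ hF hG) !cReM /=.
by rewrite !mul0r !mul1r !sub0r => /oppr_inj.
Qed.

Lemma toeplitz_theta_mul F : analytic F -> ae_circle (fun t =>
  toeplitz Theta F t = theta_mul F t).
Proof. by move=> aF; apply: hardy_proj_analytic; exact: analytic_theta_mul. Qed.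

Lemma L2_adjoint F : L2 F -> L2 (fun t => pointwise_adjoint Theta t *m F t).
Proof. by move=> hF; apply: Linfty_L2 => //; apply: Linfty_adjoint; case: hTheta =>
  [[]]. Qed.

Lemma analytic_toeplitz_adjoint F : L2 F -> analytic (toeplitz (pointwise_adjoint
  Theta) F).
Proof. by move=> hF; apply: analytic_proj; exact: L2_adjoint. Qed.

Lemma inner_toeplitz_adjoint F K : L2 F -> analytic K ->
  inner (toeplitz (pointwise_adjoint Theta) F) K = inner F (theta_mul K).
Proof.
move=> hF aK; have hA := L2_adjoint hF; have [aP hP] := hardy_projP hA.
rewrite /theta_mul -inner_adjoint; apply/esym/eqP; rewrite -subr_eq0.
by rewrite -(innerBl hA (analytic_L2 aP) (analytic_L2 aK)); apply/eqP; exact: hP.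
Qed.

(** The scalar e^{it} commutes with the matrix Theta; on the adjoint side this makes T_{Theta^*}
    commute with S^*. *)
Lemma theta_mul_mul_expi F : theta_mul (mul_expi F) = mul_expi (theta_mul F).
Proof. by apply/funext => t; rewrite /theta_mul /mul_expi scalemxAr. Qed.

Lemma inner_toeplitz_backward_shift F K : analytic F -> analytic K ->
  inner (toeplitz (pointwise_adjoint Theta) (backward_shift F)) K =
  inner F (theta_mul (mul_expi K)).
Proof.
move=> aF aK; rewrite (inner_toeplitz_adjoint (analytic_L2 (analytic_backward_shift
  aF)) aK).
by rewrite (inner_backward_shift aF (analytic_theta_mul aK)) theta_mul_mul_expi.
Qed.

Lemma inner_backward_shift_toeplitz F K : L2 F -> analytic K ->
  inner (backward_shift (toeplitz (pointwise_adjoint Theta) F)) K =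
  inner F (theta_mul (mul_expi K)).
Proof.
move=> hF aK; rewrite (inner_backward_shift (analytic_toeplitz_adjoint hF) aK).
exact: inner_toeplitz_adjoint hF (analytic_mul_expi aK).
Qed.

Lemma toeplitz_backward_shift_ae F : analytic F ->
  ae_circle (fun t => toeplitz (pointwise_adjoint Theta) (backward_shift F) t =
                      backward_shift (toeplitz (pointwise_adjoint Theta) F) t).
Proof.
move=> aF; apply: analytic_eq.
- by apply/analytic_toeplitz_adjoint/analytic_L2/analytic_backward_shift.
- by apply/analytic_backward_shift/analytic_toeplitz_adjoint/analytic_L2.
- move=> K aK; rewrite (inner_toeplitz_backward_shift aF aK).
  by rewrite (inner_backward_shift_toeplitz (analytic_L2 aF) aK).
Qed.

(** * The finite-rank perturbation and its kernel *)

Variables (n : nat) (G H : 'I_n -> R -> 'cV[R[i]]_m).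
Hypothesis hG : orthonormal_in_H2 G.
Hypothesis hH : orthonormal_in_H2 H.

Let aG i : analytic (G i). Proof. by apply/H2P; case: hG. Qed.
Let aH i : analytic (H i). Proof. by apply/H2P; case: hH. Qed.

Definition perturbation F : R -> 'cV[R[i]]_m := \sum_(i < n) inner F (G i) *: H i.

Lemma analytic_perturbation F : analytic (perturbation F).
Proof. by apply: analytic_sum => i; exact: analyticZ. Qed.

Lemma perturbationE F :
  perturbation F = combination (fun i => inner F (extend_ord 0 G i)) (extend_ord 0 H) n.
Proof. by apply: eq_bigr => i _; rewrite !extend_ordE. Qed.

Lemma orthonormal_extend (X : 'I_n -> R -> 'cV[R[i]]_m) : orthonormal_in_H2 X ->
  orthonormal_seq (extend_ord 0 X) n.
Proof.
move=> [hX oX]; split.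
  move=> i; rewrite /extend_ord; case: (insub i) => [j|] /=; last exact: analytic0.
  by apply/H2P.
move=> i j lin ljn.
by rewrite (extend_ordE 0 X (Ordinal lin)) (extend_ordE 0 X (Ordinal ljn)) oX.
Qed.

(** Orthonormality of H turns the left side into the sum of the |<F, G_i>|^2, which Bessel's
    inequality for G bounds. *)
Lemma sqnorm_perturbation_le F : L2 F -> sqnorm (perturbation F) <= sqnorm F.
Proof.
move=> hF; rewrite perturbationE (sqnorm_combination _ (orthonormal_extend hH)).
exact: (bessel_orthonormal (orthonormal_extend hG)).
Qed.

Lemma perturbationD F K : L2 F -> L2 K ->
  perturbation (F + K) = perturbation F + perturbation K.
Proof.
move=> hF hK; rewrite /perturbation -big_split; apply: eq_bigr => i _ /=.
by rewrite (innerDl hF hK (analytic_L2 (aG i))) scalerDl.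
Qed.

Lemma perturbationZ (a : R[i]) F : L2 F -> perturbation (a *: F) = a *: perturbation F.
Proof.
move=> hF; rewrite /perturbation scaler_sumr; apply: eq_bigr => i _ /=.
by rewrite (innerZl _ hF (analytic_L2 (aG i))) scalerA.
Qed.

(** Theta F already lies in H^2, so the projection inside [toeplitz] acts on it as the identity
    almost everywhere and drops out. *)
Lemma kernelP F : kernel_on_H2 (perturbed_toeplitz Theta G H) F <->
  analytic F /\ ae_circle (fun t => (theta_mul F + perturbation F) t = 0).
Proof.
split=> [[/H2P aF h]|[aF h]]; (split; first by [|apply/H2P]).
  apply: ae_circleS (ae_circleI h (toeplitz_theta_mul aF)) => t _ [e1 e2].
  by rewrite fctE -e2 -e1.
apply: ae_circleS (ae_circleI h (toeplitz_theta_mul aF)) => t _ [e1 e2].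
by rewrite /perturbed_toeplitz fctE e2 -e1.
Qed.

Lemma sqnorm_theta_mulD_perturbation F : L2 F ->
  sqnorm (theta_mul F + perturbation F) <= 4 * sqnorm F.
Proof.
move=> hF.
apply: le_trans (sqnormD_le (L2_theta_mul hF) (analytic_L2 (analytic_perturbation
  F))) _.
rewrite (sqnorm_theta_mul hF); have := sqnorm_perturbation_le hF.
by move: (sqnorm _) (sqnorm _) => x y; lra.
Qed.

Lemma closed_kernel : closed_subspace_of_H2 (kernel_on_H2 (perturbed_toeplitz Theta
  G H)).
Proof.
split; first split.
- by move=> F [].
- apply/kernelP; split; first exact: analytic0.
  rewrite -(scale0r (0 : R -> 'cV[R[i]]_m)) theta_mulZ (perturbationZ _ L2_0)
    !scale0r addr0.
  exact: ae_circleT.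
- move=> a F K /kernelP [aF eF] /kernelP [aK eK]; apply/kernelP.
  have hF := analytic_L2 aF; have hK := analytic_L2 aK.
  split; first exact: analyticD (analyticZ _ aF) aK.
  rewrite theta_mulD theta_mulZ (perturbationD (L2Z a hF) hK) (perturbationZ _ hF).
  rewrite addrACA -scalerDr.
  apply: ae_circleS (ae_circleI eF eK) => t _ [e1 e2].
  by rewrite (_ : (_ + _) t = a *: (theta_mul F + perturbation F) t +
    (theta_mul K + perturbation K) t) // e1 e2 scaler0 addr0.
move=> F [hF happ]; apply/kernelP.
have app e : 0 < e -> exists K, [/\ analytic K, sqnorm (F - K) < e &
    ae_circle (fun t => (theta_mul K + perturbation K) t = 0)].
  move=> e0; have [K /kernelP [aK eK] FK] := happ e e0.
  by exists K; split => //; rewrite -lte_fin -(L2sqnormE (L2B hF (analytic_L2 aK))).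
have aF : analytic F by apply: analytic_lim => // e /app [K [aK FK _]]; exists K.
split; first exact: aF.
have hT X : L2 X -> L2 (theta_mul X + perturbation X).
  by move=> hX; exact: L2D (L2_theta_mul hX) (analytic_L2 (analytic_perturbation X)).
apply: (sqnorm0_ae (hT _ hF)); apply/eqP; rewrite eq_le sqnorm_ge0 andbT.
apply: (@le_epsilon0 _ _ 4) => // e e0; have [K [aK FK eK]] := app e e0.
have hK := analytic_L2 aK; have hFK := L2B hF hK.
(* K is in the kernel, so F and F - K have the same image almost everywhere; boundedness then makes
   it arbitrarily small. *)
rewrite (sqnorm_ae (G := theta_mul (F - K) + perturbation (F - K)) (hT _ hF) (hT _
  hFK)).
  apply: le_trans (sqnorm_theta_mulD_perturbation hFK) _.
  by rewrite ler_wpM2l // ltW.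
apply: ae_circleS eK => t _ e1.
have -> : theta_mul F + perturbation F = (theta_mul (F - K) + perturbation (F - K)) +
    (theta_mul K + perturbation K).
  by rewrite addrACA -theta_mulD -(perturbationD hFK hK) subrK.
by rewrite -[RHS]addr0 -e1.
Qed.

Lemma kernel_backward_shift F :
  kernel_on_H2 (perturbed_toeplitz Theta G H) F ->
  ae_circle (fun t => backward_shift F t =
    (\sum_(i < n) (- inner F (G i)) *:
       toeplitz (pointwise_adjoint Theta) (backward_shift (H i))) t).
Proof.
move=> /kernelP [aF eF]; have hF := analytic_L2 aF.
have aT i : analytic (toeplitz (pointwise_adjoint Theta) (backward_shift (H i))).
  by apply/analytic_toeplitz_adjoint/analytic_L2/analytic_backward_shift.
apply: analytic_eq; first exact: analytic_backward_shift.
  by apply: analytic_sum => i; exact: analyticZ.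
move=> K aK; have aK' := analytic_mul_expi aK; have hK' := analytic_L2 aK'.
rewrite (inner_backward_shift aF aK) -(inner_theta_mul hF hK').
have hTK := L2_theta_mul hK'.
have : inner (theta_mul F + perturbation F) (theta_mul (mul_expi K)) = 0.
  have hT := L2D (L2_theta_mul hF) (analytic_L2 (analytic_perturbation F)).
  by rewrite (inner_ae hT L2_0 hTK eF) (inner0l hTK).
rewrite (innerDl (L2_theta_mul hF) (analytic_L2 (analytic_perturbation F)) hTK) => /eqP.
rewrite addr_eq0 => /eqP ->.
rewrite /perturbation (inner_suml _ (fun i => L2Z _ (analytic_L2 (aH i))) hTK).
rewrite (inner_suml _ (fun i => L2Z _ (analytic_L2 (aT i))) (analytic_L2 aK)) -sumrN.
apply: eq_bigr => i _; rewrite (innerZl _ (analytic_L2 (aH i)) hTK) (innerZl _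
  (analytic_L2 (aT i)) (analytic_L2 aK)).
by rewrite (inner_toeplitz_backward_shift (aH i) aK) mulNr.
Qed.

End InnerMultiplier.
End Kernel.

Theorem theorem3p1 (R : realType) (m n : nat) (hm : (1 <= m)%N) (hn : (1 <= n)%N)
    (Theta : R -> 'M[R[i]]_m) (G H : 'I_n -> R -> 'cV[R[i]]_m)
    (hTheta : inner_multiplier Theta)
    (hG : orthonormal_in_H2 G) (hH : orthonormal_in_H2 H) :
  nearly_backward_invariant_defect_le
    (kernel_on_H2 (perturbed_toeplitz Theta G H)) n
    (closed_span (fun i =>
       toeplitz (pointwise_adjoint Theta) (backward_shift (H i)))) /\
  closed_span (fun i =>
    toeplitz (pointwise_adjoint Theta) (backward_shift (H i))) =
  closed_span (fun i =>
    backward_shift (toeplitz (pointwise_adjoint Theta) (H i))).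
Proof.
have aH i : analytic (H i) by apply/H2P; case: hH.
have aT i : analytic (toeplitz (pointwise_adjoint Theta) (backward_shift (H i))).
  by apply: (analytic_toeplitz_adjoint hTheta); apply/analytic_L2/analytic_backward_shift.
have aB i : analytic (backward_shift (toeplitz (pointwise_adjoint Theta) (H i))).
  by apply/analytic_backward_shift/(analytic_toeplitz_adjoint hTheta)/analytic_L2.
have hTB i := toeplitz_backward_shift_ae hTheta (aH i).
split; last first.
  apply/seteqP; split; apply: closed_span_ae => // i.
  by apply: ae_circleS (hTB i) => t _ ->.
split.
- exact: closed_kernel.
- exact: subspace_closed_span.
- exact: has_dim_closed_span.
move=> F kF _; have hsum := kernel_backward_shift hTheta hH kF.
(* The kernel component is 0: the combination from [kernel_backward_shift] is the whole of S^*F, up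
   to a null set. *)
exists 0, (\sum_(i < n) (- inner F (G i)) *:
  toeplitz (pointwise_adjoint Theta) (backward_shift (H i))); split.
- by case: (closed_kernel hTheta hG hH) => [[]].
- have aS : analytic (\sum_(i < n) (- inner F (G i)) *:
      toeplitz (pointwise_adjoint Theta) (backward_shift (H i))).
    by apply: analytic_sum => i; exact: analyticZ.
  split; first exact: analytic_L2.
  move=> e e0; eexists; first by exists (fun i => - inner F (G i)).
  by rewrite subrr (L2sqnormE L2_0) (sqnormE L2_0) (inner0l L2_0) lte_fin.
- by rewrite add0r.
Qed.
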